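(* Let $\pi'$ be a refinement of $\pi$. If $A\in\Sigma$, then $A'\in\Sigma'$ and $$p_{A'}=p_Ap_{\pi'}=p_{\pi'}p_A=p_A\wedge p_{\pi'}.$$ In particular $p_A$ and $p_{\pi'}$ commute and $\mathcal H_{A'}=\mathcal H_A\cap\mathcal H_{\pi'}$.
   Context: Let $\mathcal H$ be a complex Hilbert space. A projection is a bounded self-adjoint idempotent operator; $p\wedge q$ (and $\wedge_\alpha p_\alpha$) is the projection onto the intersection of ranges. For $\phi\neq0$, $\hat\phi=\phi/\|\phi\|$. Sums of countably many operators are understood strongly. A family $\rho=\{p^t_a:t\in T,\ a\in\Delta(t)\}$ of projections, with $T$ a set, each $\Delta(t)$ countable and $\sum_{a\in\Delta(t)}p^t_a=I$ for each $t$, determines: $p^{t_1,\dots,t_k}_{a_1,\dots,a_k}=\wedge_ip^{t_i}_{a_i}$; $\mathcal H_\rho$ = the closed subspace of $\phi$ on which $\rho$ commutes ($W\phi=V\phi$ whenever $W,V$ are finite products of elements of $\rho$ with the same factors, with multiplicity, in possibly different orders), with projection $p_\rho$; $\Omega_\rho=\prod_{t\in T}\Delta(t)$, $X_t(\omega)=\omega_t$, $\Sigma_\rho$ the σ-algebra generated by the sets $\{X_t=a\}$; for $\phi\in\mathcal H_\rho\setminus\{0\}$, $\mathbb P_\phi$ the unique probability measure on $(\Omega_\rho,\Sigma_\rho)$ with $\mathbb P_\phi(X_{t_i}=a_i,\ i\le k)=\|p^{t_1,\dots,t_k}_{a_1,\dots,a_k}\hat\phi\|^2$; and for $A\in\Sigma_\rho$,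 $\mathcal H_A=\{\phi\in\mathcal H_\rho:\phi=0\text{ or }\mathbb P_\phi(A)=1\}$ with projection $p_A$. Let $\pi=\{p^t_a:t\in S,a\in\Gamma(t)\}$ be such a family with $\Omega=\Omega_\pi$, $\Sigma=\Sigma_\pi$. A refinement of $\pi$ is such a family $\pi'=\{p^t_b:t\in S',\ b\in\Gamma'(t)\}$ (with associated $\Omega'$, $\Sigma'$, and $p_{A'}$, $\mathcal H_{A'}$ defined relative to $\pi'$) where $S\subset S'$ and, for each $t\in S$, $\Gamma'(t)$ is the disjoint union of sets $\Gamma'_a(t)$, $a\in\Gamma(t)$, with $p^t_a=\sum_{b\in\Gamma'_a(t)}p^t_b$. For $A\subset\Omega$, $A'=\{\omega'\in\Omega':$ for some $\omega\in A$, $\omega'(t)\in\Gamma'_{\omega(t)}(t)$ for all $t\in S\}$. *)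

(* Defs.v *)
(* MathComp + MathComp-Analysis + real-closed (complex numbers R[i]). *)
From HB Require Import structures.
From mathcomp Require Import all_boot all_order all_algebra.
From mathcomp Require Import complex.
From mathcomp Require Import finmap.
From mathcomp Require Import boolp classical_sets functions reals ereal measure.
From Stdlib Require Import List Permutation ClassicalEpsilon.

Unset Strict Implicit.
Unset Printing Implicit Defensive.
Import GRing.Theory Num.Theory.
Local Open Scope ring_scope.
Local Open Scope classical_set_scope.

(* A complex Hilbert space is given by a type H with a vector-space        *)
(* structure over C = R[i] (R : realType), an inner product ip (linear in *)
(* the first argument, conjugate symmetric, positive definite) for which  *)
(* H is complete for the induced norm.                                     *)

Section Hilbert.
Variable R : realType.
Variable H : lmodType R[i].
Variable ip : H -> H -> R[i].

Definition is_inner_product : Prop :=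
  [/\ (forall (c : R[i]) (x y z : H), ip (c *: x + y) z = c * ip x z + ip y z),
      (forall x y : H, ip y x = (ip x y)^*),
      (forall x : H, 0 <= ip x x) &
      (forall x : H, ip x x = 0 -> x = 0)].

(* squared norm *)
Definition sqnorm (x : H) : R[i] := ip x x.
Definition hnorm (x : H) : R[i] := sqrtC (ip x x).
Definition hat (x : H) : H := (hnorm x)^-1 *: x.

(* norm convergence of a sequence *)
Definition seq_cvg (u : nat -> H) (x : H) : Prop :=
  forall e : R[i], 0 < e -> exists N : nat, forall n, (N <= n)%N ->
    sqnorm (u n - x) < e.

Definition seq_cauchy (u : nat -> H) : Prop :=
  forall e : R[i], 0 < e -> exists N : nat, forall n m, (N <= n)%N -> (N <= m)%N ->
    sqnorm (u n - u m) < e.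

Definition is_complete : Prop :=
  forall u : nat -> H, seq_cauchy u -> exists x, seq_cvg u x.

Definition is_hilbert : Prop := is_inner_product /\ is_complete.

(* bounded operators, projections *)
Definition is_linear_op (T : H -> H) : Prop :=
  forall (c : R[i]) (x y : H), T (c *: x + y) = c *: T x + T y.

Definition is_bounded_op (T : H -> H) : Prop :=
  exists M : R[i], forall x, sqnorm (T x) <= M * sqnorm x.

Definition is_projection (P : H -> H) : Prop :=
  [/\ is_linear_op P, is_bounded_op P,
      (forall x, P (P x) = P x) &
      (forall x y, ip (P x) y = ip x (P y))].

(* the projection onto a (closed) subspace V *)
Definition proj (V : set H) : H -> H :=
  epsilon (inhabits (fun x : H => x))
    (fun P => is_projection P /\ range P = V).

(* p /\ q : projection onto the intersection of ranges *)
Definition pmeet (P Q : H -> H) : H -> H := proj (range P `&` range Q).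

(* projection onto the intersection of ranges of a finite family *)
Definition pmeet_list (l : list (H -> H)) : H -> H :=
  proj (fun x => forall P, In P l -> range P x).

(* strong (unconditional) sum of the family f over the indices in Q *)
Definition strong_sum_on (D : countType) (Q : D -> Prop) (f : D -> H -> H)
    (T : H -> H) : Prop :=
  forall (x : H) (e : R[i]), 0 < e ->
    exists F0 : {fset D}, (forall a, a \in F0 -> Q a) /\
      forall F : {fset D}, (F0 `<=` F)%fset -> (forall a, a \in F -> Q a) ->
        sqnorm (\sum_(a <- F) f a x - T x) < e.

Definition strong_sum (D : countType) (f : D -> H -> H) (T : H -> H) : Prop :=
  strong_sum_on D (fun _ : D => True) f T.

(* Families rho = {p^t_a : t in T, a in Delta t}                           *)
Section Family.
Variables (T : Type) (Delta : T -> countType) (p : forall t, Delta t -> H -> H).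

Definition is_pvm_family : Prop :=
  (forall t a, is_projection (p t a)) /\
  (forall t, strong_sum (Delta t) (p t) (fun x => x)).

(* an element of the family *)
Definition in_family (W : H -> H) : Prop := exists t (a : Delta t), W = p t a.

Definition prod_ops (l : list (H -> H)) : H -> H :=
  fold_right (fun W V x => W (V x)) (fun x => x) l.

(* H_rho *)
Definition H_comm : set H := fun phi =>
  forall l1 l2 : list (H -> H), Forall in_family l1 -> Permutation l1 l2 ->
    prod_ops l1 phi = prod_ops l2 phi.

Definition p_comm : H -> H := proj H_comm.

(* Omega_rho and Sigma_rho *)
Definition Omega := forall t, Delta t.

Definition cylinders : set (set Omega) :=
  fun B => exists t (a : Delta t), B = [set w : Omega | w t = a].

Definition Sigma : set (set Omega) := <<s cylinders >>.

Definition index := {t : T & Delta t}.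

Definition cyl_of (l : list index) : set Omega :=
  [set w : Omega | forall i, In i l -> w (projT1 i) = projT2 i].

Definition proj_of (l : list index) : H -> H :=
  pmeet_list (map (fun i => p (projT1 i) (projT2 i)) l).

(* mu is a probability measure on (Omega, Sigma): only its values on
   Sigma matter. sigma-additivity on nonnegative terms is expressed with
   the supremum of the (nondecreasing) partial sums. *)
Definition is_probability (mu : set Omega -> \bar R) : Prop :=
  [/\ mu set0 = 0%E,
      (forall B, Sigma B -> (0 <= mu B)%E),
      (forall F : nat -> set Omega, (forall n, Sigma (F n)) ->
         trivIset setT F ->
         mu (\bigcup_n F n) =
           ereal_sup (range (fun n => (\sum_(0 <= i < n) mu (F i))%E))) &
      mu setT = 1%E].

(* mu is (the) measure P_phi *)
Definition is_P_phi (phi : H) (mu : set Omega -> \bar R) : Prop :=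
  is_probability mu /\
  forall l : list index,
    mu (cyl_of l) = (complex.Re (sqnorm (proj_of l (hat phi))))%:E.

(* H_A *)
Definition H_event (A : set Omega) : set H := fun phi =>
  H_comm phi /\
  (phi = 0 \/ exists mu, is_P_phi phi mu /\ mu A = 1%E).

Definition p_event (A : set Omega) : H -> H := proj (H_event A).

End Family.

(* Refinements. S is a subset of S'; pi is indexed by {t | S t}.          *)
(* For t in S, Gamma'(t) is the disjoint union of the Gamma'_a(t),        *)
(* a in Gamma(t), encoded by the map blk t : Gamma'(t) -> Gamma(t)        *)
(* (Gamma'_a(t) = {b | blk t b = a}).                                      *)
Section Refinement.
Variables (S' : Type) (S : set S').
Variables (Gam : {t : S' | S t} -> countType)
          (p : forall t, Gam t -> H -> H).
Variables (Gam' : S' -> countType) (p' : forall t, Gam' t -> H -> H).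
Variable blk : forall t : {t : S' | S t}, Gam' (proj1_sig t) -> Gam t.

Definition is_refinement : Prop :=
  [/\ is_pvm_family _ Gam p, is_pvm_family _ Gam' p' &
      forall (t : {t : S' | S t}) (a : Gam t),
        strong_sum_on (Gam' (proj1_sig t)) (fun b => blk t b = a)
          (p' (proj1_sig t)) (p t a)].

(* A' *)
Definition lift_event (A : set (Omega _ Gam)) : set (Omega _ Gam') :=
  fun w' => exists w, A w /\
    forall t : {t : S' | S t}, blk t (w' (proj1_sig t)) = w t.

End Refinement.
End Hilbert.

(* Main.v *)
(** For [x] in the commuting subspace put [m_x(l) := |p_l x|^2] for every
finite list [l] of conditions [X_t = a].  Since [sum_a p^t_a = I], these numbers
form a consistent family and extend to a finite measure [mu_x] on the product
sigma-algebra; being determined by its values on cylinders, [mu_x] inherits the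
identities satisfied by [|p_l x|^2].  A nonzero vector [x] is in [H_A] iff
[mu_x(~A) = 0].

- The parallelogram law [mu_(x+y) + mu_(x-y) = 2 mu_x + 2 mu_y] shows that [H_A]
  is a closed subspace.
- If [x] commutes with the refinement, [mu_x] is the image of [mu'_x] under the
  coarsening map [Omega' -> Omega], whence [H_A' = H_A `&` H_pi'].
- [p_pi'] commutes with every [p'^t_b], hence with every [p^t_a], so Pythagoras
  gives [mu_x = mu_(p_pi' x) + mu_(x - p_pi' x)] and [p_pi'] maps [H_A] to itself;
  a projection leaving a closed subspace invariant commutes with its projection. *)

Require Import Defs.
From HB Require Import structures.
From mathcomp Require Import all_boot all_order all_algebra.
From mathcomp Require Import complex finmap.
From mathcomp Require Import boolp classical_sets functions cardinality fsbigop reals ereal.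
From mathcomp Require Import sequences esum measure.
From mathcomp Require Import ring lra.
From Stdlib Require Import List Permutation ClassicalEpsilon.
Import Order.TTheory GRing.Theory Num.Theory.
Local Open Scope ring_scope.
Local Open Scope classical_set_scope.

(** * Finite measures on a sigma-algebra *)

Section FiniteMeasures.
Variable R : realType.
Local Open Scope ereal_scope.

Lemma esum_exchange (I J : choiceType) (P : set I) (Q : set J)
    (f : I -> J -> \bar R) : (forall i j, 0 <= f i j) ->
  \esum_(i in P) \esum_(j in Q) f i j = \esum_(j in Q) \esum_(i in P) f i j.
Proof.
move=> f0; rewrite (@esum_esum _ _ _ P (fun=> Q))// (@esum_esum _ _ _ Q (fun=> P))//.
rewrite (reindex_esum (Q `*`` (fun=> P)) _ (fun x => (x.2, x.1)))//; split=> //=.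
- by move=> [i j] [/=].
- by move=> [i1 i2] [j1 j2] /= _ _ [] -> ->.
- by move=> [i1 i2] [Pi1 Qi2] /=; exists (i2, i1).
Qed.

Lemma nneseries_sup (f : nat -> \bar R) : (forall n, 0 <= f n) ->
  \sum_(n <oo) f n = ereal_sup (range (fun n => \sum_(0 <= i < n) f i)).
Proof.
move=> f0; apply/cvg_lim => //; apply: ereal_nondecreasing_cvgn.
by apply: ereal_nondecreasing_series => i _ _; exact: f0.
Qed.

(** When [A] is a sigma-algebra, only the values of [mu] on [A] are constrained. This matches
    measures given as plain functions on all subsets. *)
Definition fin_measure_on (X : Type) (A : set (set X)) (mu : set X -> \bar R) :=
  [/\ mu set0 = 0, (forall B, A B -> 0 <= mu B),
      (forall F : nat -> set X, (forall n, A (F n)) -> trivIset setT F ->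
         mu (\bigcup_n F n) = \sum_(n <oo) mu (F n)) &
      mu setT < +oo].

Section OnSigmaAlgebra.
Context {X : Type} {G : set (set X)}.
Implicit Types mu nu : set X -> \bar R.

Lemma sigma_setC (A : set X) : <<s G >> A -> <<s G >> (~` A).
Proof. by move=> GA; rewrite -setTD; exact: sigma_algebraCD. Qed.

Lemma sigma_setT : <<s G >> setT.
Proof. by have := sigma_setC set0 (@sigma_algebra0 _ setT G); rewrite setC0. Qed.

Lemma sigma_setI (A B : set X) : <<s G >> A -> <<s G >> B -> <<s G >> (A `&` B).
Proof.
move=> GA GB; rewrite -[A `&` B]setCK setCI -bigcup2E.
apply: (sigma_setC _ (sigma_algebra_bigcup _)) => -[|[|n]] /=.
- exact: sigma_setC.
- exact: sigma_setC.
- exact: sigma_algebra0.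
Qed.

Lemma sigma_countable_bigcup (D : countType) (Q : set D) (F : D -> set X) :
  (forall b, Q b -> <<s G >> (F b)) -> <<s G >> (\bigcup_(b in Q) F b).
Proof.
move=> GF.
(* Numbers that decode to nothing, or to an index outside [Q], contribute the empty set. *)
pose E n := if (@choice.unpickle D n) is Some b then
  if pselect (Q b) then F b else set0 else set0.
have -> : \bigcup_(b in Q) F b = \bigcup_n E n.
  apply/seteqP; split => [x [b Qb Fx]|x [n _]].
    by exists (choice.pickle b) => //; rewrite /E choice.pickleK; case: pselect.
  by rewrite /E; case: choice.unpickle => // b; case: pselect => // Qb Fx; exists b.
apply: sigma_algebra_bigcup => n; rewrite /E.
case: choice.unpickle => [b|]; last exact: sigma_algebra0.
by case: pselect => Qb; [exact: GF|exact: sigma_algebra0].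
Qed.

Lemma fin_measureU {mu} : fin_measure_on X <<s G >> mu ->
  forall A B, <<s G >> A -> <<s G >> B -> A `&` B = set0 ->
  mu (A `|` B) = mu A + mu B.
Proof.
move=> [mu0 mupos muS _] A B GA GB AB.
rewrite -bigcup2E muS; last first.
- by apply/trivIsetP => -[|[|i]] [|[|j]] //= _ _ _; rewrite ?set0I ?setI0// setIC.
- by move=> [|[|n]] //=; exact: sigma_algebra0.
rewrite (nneseries_split 0 2)/=; last first.
  by move=> [|[|k]] _ //=; [exact: mupos|exact: mupos|rewrite mu0].
rewrite eseries0 ?adde0; last by move=> [|[|i]].
by rewrite add0n big_nat_recr//= big_nat1.
Qed.

Lemma fin_measureC {mu} : fin_measure_on X <<s G >> mu ->
  forall A, <<s G >> A -> mu A + mu (~` A) = mu setT.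
Proof.
move=> hmu A GA; rewrite -(fin_measureU hmu) ?setUv ?setICr//; exact: sigma_setC.
Qed.

Lemma fin_measure_fin {mu} : fin_measure_on X <<s G >> mu ->
  forall A, <<s G >> A -> mu A \is a fin_num.
Proof.
move=> hmu A GA; case: (hmu) => _ pos _ fin.
rewrite ge0_fin_numE ?pos//; apply: le_lt_trans fin.
by rewrite -(fin_measureC hmu A GA) leeDl// pos//; exact: sigma_setC.
Qed.

(** Dynkin's argument: the sets where [mu] and [nu] agree form a lambda-system. Finiteness allows
    the common value to be subtracted when passing to complements. *)
Lemma fin_measure_unique {mu nu} (C : set (set X)) :
  setI_closed C -> C setT -> <<s G >> `<=` <<s C >> -> C `<=` <<s G >> ->
  fin_measure_on X <<s G >> mu -> fin_measure_on X <<s G >> nu ->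
  (forall A, C A -> mu A = nu A) -> forall A, <<s G >> A -> mu A = nu A.
Proof.
move=> IC CT GC CG hmu hnu eqC A GA.
have T_eq := eqC _ CT.
suff /(_ A (GC _ GA))[] : <<s C >> `<=` [set B | <<s G >> B /\ mu B = nu B] by [].
rewrite -setI_closed_g_dynkin_g_sigma_algebra//; apply: smallest_sub; last first.
  by move=> B CB; split; [exact: CG|exact: eqC].
split => /=.
- by split => //; exact: sigma_setT.
- move=> B [GB eB]; split; first exact: sigma_setC.
  have := fin_measureC hmu B GB; rewrite T_eq -(fin_measureC hnu B GB) eB.
  have := fin_measure_fin hnu B GB; case: (nu B) => // r _.
  by move/(congr1 (fun y => y - r%:E)); rewrite ![r%:E + _]addeC !addeK.
- move=> F tF FE; split.
    by apply: sigma_algebra_bigcup => n; have [] := FE n.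
  case: hmu hnu => _ _ muS _ [_ _ nuS _].
  have GF n : <<s G >> (F n) by have [] := FE n.
  rewrite muS// nuS//.
  by apply: eq_eseriesr => n _; have [] := FE n.
Qed.

Lemma fin_measure_add {mu nu} : fin_measure_on X <<s G >> mu ->
  fin_measure_on X <<s G >> nu -> fin_measure_on X <<s G >> (fun A => mu A + nu A).
Proof.
move=> [mu0 mup muS muT] [nu0 nup nuS nuT]; split.
- by rewrite mu0 nu0 adde0.
- by move=> B GB; rewrite adde_ge0 ?mup ?nup.
- move=> F GF tF; rewrite muS// nuS// nneseriesD// => n _ _; [exact: mup|exact: nup].
- by rewrite lte_add_pinfty.
Qed.

Lemma fin_measure_scale {mu} (c : R) : (0 <= c)%R -> fin_measure_on X <<s G >> mu ->
  fin_measure_on X <<s G >> (fun A => c%:E * mu A).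
Proof.
move=> c0 hmu; have fT := fin_measure_fin hmu _ sigma_setT.
case: hmu => mu0 mup muS muT; split.
- by rewrite mu0 mule0.
- by move=> B GB; rewrite mule_ge0 ?mup ?lee_fin.
- by move=> F GF tF; rewrite muS// nneseriesZl// => n _; exact: mup.
- by rewrite ltey_eq fin_numM.
Qed.

Lemma fin_measure_bigcup {mu} (D : countType) (Q : set D) (F : D -> set X) :
  fin_measure_on X <<s G >> mu -> (forall b, Q b -> <<s G >> (F b)) ->
  (forall b c, Q b -> Q c -> b <> c -> F b `&` F c = set0) ->
  mu (\bigcup_(b in Q) F b) = \esum_(b in Q) mu (F b).
Proof.
move=> [mu0 mup muS _] GF dF.
(* The test [choice.pickle b = n] keeps the sets [E n] disjoint, since several numbers may decode to
   the same [b]. *)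
pose E n := if (@choice.unpickle D n) is Some b then
  if pselect (Q b /\ choice.pickle b = n) then F b else set0 else set0.
have EF b : Q b -> E (choice.pickle b) = F b.
  by move=> Qb; rewrite /E choice.pickleK; case: pselect => // -[].
have EN n : ~ (exists2 b, Q b & choice.pickle b = n) -> E n = set0.
  move=> nb; rewrite /E; case: choice.unpickle => // b; case: pselect => // -[Qb bn].
  by exfalso; apply: nb; exists b.
have GE n : <<s G >> (E n).
  have [[b Qb <-]|/EN->] := pselect (exists2 b, Q b & choice.pickle b = n).
    by rewrite EF//; exact: GF.
  exact: sigma_algebra0.
have -> : \bigcup_(b in Q) F b = \bigcup_n E n.
  apply/seteqP; split => [x [b Qb Fx]|x [n _]].
    by exists (choice.pickle b) => //; rewrite EF.
  have [[b Qb <-]|/EN->//] := pselect (exists2 b, Q b & choice.pickle b = n).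
  by rewrite EF// => Fx; exists b.
rewrite muS//; last first.
  apply/trivIsetP => i j _ _ ij.
  have [[b Qb bi]|/EN->] := pselect (exists2 b, Q b & choice.pickle b = i); last by rewrite set0I.
  have [[c Qc cj]|/EN->] := pselect (exists2 b, Q b & choice.pickle b = j); last by rewrite setI0.
  rewrite -bi -cj !EF//; apply: dF => // bc.
  by move: ij; rewrite -bi -cj bc eqxx.
rewrite nneseries_esumT => [|n]; last exact: mup.
have pinj : set_inj Q (@choice.pickle D) by move=> x y _ _; exact: (pcan_inj choice.pickleK).
transitivity (\esum_(n in choice.pickle @` Q) mu (E n)); last first.
  by rewrite esum_image//; apply: eq_esum => b Qb; rewrite EF.
rewrite [RHS]esum_mkcond; apply: eq_esum => n _.
case: ifPn => //; rewrite notin_setE => nQ; rewrite EN ?mu0//.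
Qed.

End OnSigmaAlgebra.
End FiniteMeasures.

(** * Measures on products of countable sets *)

Section Kolmogorov.
Variables (R : realType) (T : Type) (D : T -> countType).
Local Notation idx := (Defs.index T D).
Local Notation cyl := (cyl_of T D).
Variable m : list idx -> R.
Hypothesis m_ge0 : forall l, 0 <= m l.
Hypothesis m_ext : forall l l', (forall i, In i l <-> In i l') -> m l = m l'.
Hypothesis m_sum : forall t l,
  \esum_(a in [set: D t]) (m (existT _ t a :: l))%:E = (m l)%:E.
Local Open Scope ereal_scope.

Let mE_ge0 l : 0 <= (m l)%:E. Proof. by rewrite lee_fin. Qed.

Lemma content_le_cat l l' : (m (l' ++ l) <= m l)%R.
Proof.
elim: l' => [//|[t a] l' IH] /=; apply: le_trans IH.
rewrite -lee_fin -[leRHS](m_sum t); apply: esum_ge.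
by exists [set a]; [split => //; exact: finite_set1|rewrite fsbig_set1].
Qed.

(** If [a] and [b] differed, [m_ext] would make two terms of the sum [m_sum] at [t] equal to [m l],
    whence [2 m l <= m l]. *)
Lemma content_consistent l t a b : (0 < m l)%R ->
  In (existT _ t a) l -> In (existT _ t b) l -> a = b.
Proof.
move=> ml la lb; apply: contrapT => ab.
have abs c : In (existT _ t c) l -> m (existT _ t c :: l) = m l.
  by move=> lc; apply: m_ext => i; split => /= [[<-|]|] //; right.
suff : (m l + m l)%:E <= (m l)%:E by rewrite lee_fin; lra.
rewrite -[leRHS](m_sum t); apply: esum_ge; exists [set a; b].
  by split => //; rewrite finite_setU; split; exact: finite_set1.
rewrite fsbigU//=; last first.
  - by move=> c [->] ba; exfalso; apply: ab.
by rewrite !fsbig_set1 abs// abs// EFinD.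
Qed.

Section CoverBound.
Variables (P : set nat) (c : nat -> list idx).

Let room l := \esum_(i in P) (m (c i ++ l))%:E < (m l)%:E.

Let room_pos l : room l -> (0 < m l)%R.
Proof.
move=> rl; rewrite -lte_fin; apply: le_lt_trans rl.
by apply: esum_ge0.
Qed.

(** If every [a] destroyed the strict inequality, summing the reverse inequalities over [a] and
    exchanging the sums would refute it for [l] itself. *)
Let room_extend l t : room l -> exists a, room (existT _ t a :: l).
Proof.
move=> rl; apply: contrapT => /forallNP no.
move: rl; rewrite /room ltNge => /negP; apply.
rewrite -[leLHS](m_sum t) -[leRHS](@eq_esum _ _ _
  (fun i => \esum_(a in [set: D t]) (m (c i ++ existT _ t a :: l))%:E)); last first.
  move=> i _; rewrite -[RHS](m_sum t); apply: eq_esum => a _; congr (_%:E).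
  by apply: m_ext => j; rewrite /= !in_app_iff /=; tauto.
rewrite esum_exchange//; apply: le_esum => a _.
by rewrite leNgt; apply/negP; exact: no.
Qed.

Let room_extend_list l ts : room l -> exists l', [/\ room l', incl l l' &
  forall t, In t ts -> exists a, In (existT _ t a) l'].
Proof.
move=> rl; elim: ts => [|t ts [l' [rl' ll' tsl']]]; first by exists l; split.
have [a ra] := room_extend l' t rl'.
exists (existT _ t a :: l'); split => //.
- by move=> i /ll' ?; right.
- by move=> s /= [<-|/tsl'[b ?]]; [exists a; left|exists b; right].
Qed.

(* If the cover had total mass smaller than [m l], coordinates could be fixed
   one after another without losing the strict inequality; the resulting point
   lies in the covered cylinder, hence in some [cyl (c i)], and once all the
   coordinates of [c i] are fixed the inequality is violated. *)
Lemma content_le_cover l : cyl l `<=` \bigcup_(i in P) cyl (c i) ->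
  (m l)%:E <= \esum_(i in P) (m (c i))%:E.
Proof.
move=> lc; rewrite leNgt; apply/negP => lt_m.
have r0 : room l.
  apply: le_lt_trans lt_m; apply: le_esum => i _.
  rewrite lee_fin (m_ext (c i ++ l) (l ++ c i)) ?content_le_cat// => j.
  by rewrite !in_app_iff; tauto.
have step n (u : {l | room l}) : {u' : {l | room l} | incl (sval u) (sval u') /\
    forall t, In t (map (@projT1 _ _) (c n)) -> exists a, In (existT _ t a) (sval u')}.
  case: u => u ru; apply: cid.
  by have [u' [ru' ? ?]] := room_extend_list u (map (@projT1 _ _) (c n)) ru; exists (exist _ u' ru').
(* Stage [n.+1] is obtained from stage [n] by fixing the coordinates of [c n], so [c i] is settled
   at stage [i.+1]. *)
pose L := fix L n : {l | room l} :=
  if n is n'.+1 then sval (step n' (L n')) else exist _ l r0.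
have Lincl n k : incl (sval (L n)) (sval (L (n + k)%N)).
  elim: k => [|k IH]; first by rewrite addn0.
  rewrite addnS; apply: incl_tran IH _; exact: (svalP (step _ (L _))).1.
have Lcons t a b n k : In (existT _ t a) (sval (L n)) ->
    In (existT _ t b) (sval (L k)) -> a = b.
  move=> /(Lincl n k) la /(Lincl k n); rewrite addnC => lb.
  exact: content_consistent (room_pos _ (svalP (L (n + k)%N))) la lb.
have pt t : {a : D t | forall b n, In (existT _ t b) (sval (L n)) -> b = a}.
  apply: cid; have [[n [a la]]|no] :=
    pselect (exists n, exists a, In (existT _ t a) (sval (L n))).
    by exists a => b k lb; exact: Lcons lb la.
  (* A coordinate fixed at no stage may take any value; [room_extend] shows that [D t] is
     inhabited. *)
  have [a _] := room_extend l t r0; exists a => b n lb.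
  by exfalso; apply: no; exists n; exists b.
pose w : Omega T D := fun t => sval (pt t).
have wl n i : In i (sval (L n)) -> w (projT1 i) = projT2 i.
  by case: i => t a /= la; rewrite /w (svalP (pt t) a n la).
have [i Pi wi] := lc w (wl 0%N).
have sub : incl (c i) (sval (L i.+1)).
  move=> [t a] ca.
  have [b lb] := (svalP (step i (L i))).2 t (in_map (@projT1 _ _) _ _ ca).
  by have /= <- := wi _ ca; rewrite (wl i.+1 _ lb).
(* As [c i] is contained in [L i.+1], the term of index [i] alone already equals [m (L i.+1)]. *)
have := svalP (L i.+1); rewrite /room ltNge => /negP; apply.
apply: esum_ge; exists [set i]; first by split => [|_ -> //]; exact: finite_set1.
rewrite fsbig_set1 lee_fin (m_ext (c i ++ _) (sval (L i.+1)))// => j.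
by rewrite in_app_iff; split => [[/sub|]|]//; right.
Qed.

End CoverBound.

(** Letting [P] be any subset of [nat] admits finite and empty covers without padding by cylinders
    of mass zero, which may not exist. *)
Definition content_outer (X : set (Omega T D)) : \bar R :=
  ereal_inf [set x | exists (P : set nat) (c : nat -> list idx),
    X `<=` \bigcup_(i in P) cyl (c i) /\ x = \esum_(i in P) (m (c i))%:E].

Lemma content_outer_le (I : countType) (J : set I) (c : I -> list idx) X :
  X `<=` \bigcup_(i in J) cyl (c i) ->
  content_outer X <= \esum_(i in J) (m (c i))%:E.
Proof.
move=> Xc; apply: ereal_inf_lbound.
exists (choice.pickle @` J), (fun n => oapp c nil (@choice.unpickle I n)); split.
  move=> x /Xc[i Ji xi]; exists (choice.pickle i); first by exists i.
  by rewrite choice.pickleK.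
rewrite esum_image; last by move=> x y _ _; exact: (pcan_inj choice.pickleK).
by apply: eq_esum => i _; rewrite choice.pickleK.
Qed.

Lemma content_outer_ge0 X : 0 <= content_outer X.
Proof. by apply: le_ereal_inf_tmp => _ [P [c [_ ->]]]; exact: esum_ge0. Qed.

Lemma content_outer_cyl l : content_outer (cyl l) = (m l)%:E.
Proof.
apply/eqP; rewrite eq_le; apply/andP; split.
  have := @content_outer_le _ setT (fun _ : unit => l) (cyl l).
  rewrite (_ : setT = [set tt]); last by apply/seteqP; split => -[].
  by rewrite esum_set1//; apply => w lw; exists tt.
by apply: le_ereal_inf_tmp => _ [P [c [lc ->]]]; exact: content_le_cover.
Qed.

Lemma content_outer0 : content_outer set0 = 0.
Proof.
apply/eqP; rewrite eq_le content_outer_ge0 andbT.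
by rewrite -(esum_set0 (fun n : nat => (m nil)%:E)); exact: content_outer_le.
Qed.

Lemma content_outer_mono :
  {homo content_outer : A B / A `<=` B >-> A <= B}.
Proof.
move=> A B AB; apply: le_ereal_inf => _ [P [c [Bc ->]]].
by exists P, c; split => //; exact: subset_trans Bc.
Qed.

Lemma content_outer_sigma_subadditive : sigma_subadditive content_outer.
Proof.
move=> A; have [[i ioo]|] := pselect (exists i, content_outer (A i) = +oo).
  rewrite (eseries_pinfty _ _ ioo) ?leey// => n _.
  by rewrite -ltNye (lt_le_trans _ (content_outer_ge0 _)).
rewrite -forallNE => Aoo.
apply/lee_addgt0Pr => e e0.
rewrite (le_trans _ (epsilon_trick _ _ (ltW e0)))//; last first.
  by move=> n; exact: content_outer_ge0.
have cov n : {Pc : set nat * (nat -> list idx) |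
    A n `<=` \bigcup_(i in Pc.1) cyl (Pc.2 i) /\
    (* The excess allowed for the [n]-th cover is [e / 2 ^ n.+1], so that all excesses together stay
       below [e]. *)
    \esum_(i in Pc.1) (m (Pc.2 i))%:E <= content_outer (A n) + (e / (2 ^ n.+1)%:R)%:E}.
  apply: cid; have en : (0 < e / (2 ^ n.+1)%:R)%R by rewrite divr_gt0// ltr0n expn_gt0.
  have fin : content_outer (A n) \is a fin_num.
    by rewrite ge0_fin_numE ?content_outer_ge0// ltey; apply/eqP; exact: Aoo.
  have [x [P [c [Ac ->]]] /ltW xS] := lb_ereal_inf_adherent en fin.
  by exists (P, c).
pose P n := (sval (cov n)).1; pose c n := (sval (cov n)).2.
apply: (@le_trans _ _ (\esum_(n in setT) \esum_(i in P n) (m (c n i))%:E)); last first.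
  rewrite nneseries_esumT; last first.
    move=> n; rewrite adde_ge0 ?content_outer_ge0// lee_fin divr_ge0//.
    exact: ltW.
  by apply: le_esum => n _; exact: (svalP (cov n)).2.
rewrite esum_esum//.
apply: (@content_outer_le _ _ (fun k : nat * nat => c k.1 k.2)).
move=> w [n _ /((svalP (cov n)).1)[i Pi wi]].
by exists (n, i).
Qed.

HB.instance Definition _ := isOuterMeasure.Build R (Omega T D) content_outer
  content_outer0 content_outer_ge0 content_outer_mono content_outer_sigma_subadditive.

(** A cover of [X] is split cylinder by cylinder: adding the condition of value [a] at [t] covers
    the part inside, adding each value [b] other than [a] covers the part outside. By [m_sum] the
    total weight is unchanged. *)
Lemma content_caratheodory (t : T) (a : D t) :
  content_outer.-caratheodory [set w : Omega T D | w t = a].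
Proof.
apply: le_caratheodory_measurable => X.
apply: le_ereal_inf_tmp => _ [P [c [Xc ->]]].
apply: (@le_trans _ _ (\esum_(i in P) (m (existT _ t a :: c i))%:E +
   \esum_(i in P) \esum_(b in ~` [set a]) (m (existT _ t b :: c i))%:E)).
  rewrite esum_esum//; apply: leeD.
    apply: content_outer_le => w [/Xc[i Pi wi] wa]; exists i => // j /= [<-//|].
    exact: wi.
  apply: (@content_outer_le _ _ (fun k : nat * D t => existT _ t k.2 :: c k.1)).
  move=> w [/Xc[i Pi wi] wa]; exists (i, w t) => // j /= [<-//|].
  exact: wi.
rewrite -esumD//; last by move=> i _; exact: esum_ge0.
apply: le_esum => i _; rewrite -[leRHS](m_sum t) [leRHS](esumID [set a])//.
by rewrite !setTI esum_set1.
Qed.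

Theorem kolmogorov_extension : exists mu : set (Omega T D) -> \bar R,
  fin_measure_on R (Omega T D) (Sigma T D) mu /\ forall l, mu (cyl l) = (m l)%:E.
Proof.
exists content_outer; split; last exact: content_outer_cyl.
have SC : Sigma T D `<=` content_outer.-caratheodory.
  apply: smallest_sub; last by move=> _ [t [a ->]]; exact: content_caratheodory.
  split; first exact: caratheodory_measurable_set0.
    by move=> A MA; rewrite setTD; exact: caratheodory_measurable_setC.
  exact: caratheodory_measurable_bigcup.
split.
- exact: content_outer0.
- by move=> B _; exact: content_outer_ge0.
- move=> F SF tF; apply/eqP; rewrite eq_le content_outer_sigma_subadditive /=.
  (* The Caratheodory inequality is tested on the union itself, whose part outside the union is
     empty. *)
  have := @caratheodory_lime_le _ _ content_outer F (fun n => SC _ (SF n)) tF (\bigcup_n F n).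
  rewrite setICr /= content_outer0 adde0.
  rewrite (eq_eseriesr (g := fun n => content_outer (F n)))// => n _.
  by congr content_outer; apply/setIidPr; exact: bigcup_sup.
- have -> : setT = cyl nil by apply/seteqP; split => // w _ i [].
  by rewrite content_outer_cyl ltry.
Qed.

End Kolmogorov.

(** * Projections in a Hilbert space *)

Section InnerProduct.
Variables (R : realType) (H : lmodType R[i]) (ip : H -> H -> R[i]).
Hypothesis hip : is_inner_product R H ip.

(** Real parts turn estimates into inequalities over [R]. On a complex subspace no orthogonality is
    lost, since testing against ['i%C *: w] recovers the imaginary part. *)
Definition rip (x y : H) : R := complex.Re (ip x y).
Definition nsq (x : H) : R := rip x x.

Local Notation sqnorm := (sqnorm R H ip).
Local Notation is_projection := (is_projection R H ip).

Lemma ipDl x y z : ip (x + y) z = ip x z + ip y z.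
Proof. by case: hip => lin _ _ _; have := lin 1 x y z; rewrite scale1r mul1r. Qed.

Lemma ip0l z : ip 0 z = 0.
Proof. by have := ipDl 0 0 z; rewrite addr0 => /esym/eqP; rewrite -subr_eq0 addrK => /eqP. Qed.

Lemma ipZl c x z : ip (c *: x) z = c * ip x z.
Proof. by case: hip => lin _ _ _; have := lin c x 0 z; rewrite addr0 ip0l addr0. Qed.

Lemma ripC x y : rip x y = rip y x.
Proof. by rewrite /rip; case: hip => _ -> _ _; case: (ip y x). Qed.

Lemma ripDl x y z : rip (x + y) z = rip x z + rip y z.
Proof. by rewrite /rip ipDl; case: (ip x z); case: (ip y z). Qed.

Lemma ripNl x z : rip (- x) z = - rip x z.
Proof. by rewrite /rip -scaleN1r ipZl mulN1r; case: (ip x z). Qed.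

Lemma ripBl x y z : rip (x - y) z = rip x z - rip y z.
Proof. by rewrite ripDl ripNl. Qed.

Lemma ripDr x y z : rip z (x + y) = rip z x + rip z y.
Proof. by rewrite ripC ripDl !(ripC _ z). Qed.

Lemma ripBr x y z : rip z (x - y) = rip z x - rip z y.
Proof. by rewrite ripC ripBl !(ripC _ z). Qed.

Lemma ripZl (c : R) x z : rip (c%:C%C *: x) z = c * rip x z.
Proof. by rewrite /rip ipZl; case: (ip x z) => a b /=; rewrite mul0r subr0. Qed.

Lemma ripZr (c : R) x z : rip z (c%:C%C *: x) = c * rip z x.
Proof. by rewrite ripC ripZl ripC. Qed.

Lemma ip_eq_rip x y x' y' : rip x y = rip x' y' ->
  rip ('i%C *: x) y = rip ('i%C *: x') y' -> ip x y = ip x' y'.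
Proof.
rewrite /rip !ipZl; case: (ip x y) => a b; case: (ip x' y') => a' b' /= -> /eqP.
by rewrite !mul0r !mul1r !sub0r eqr_opp => /eqP ->.
Qed.

Lemma sqnormE x : sqnorm x = (nsq x)%:C%C.
Proof.
rewrite /Defs.sqnorm /nsq /rip; case: hip => _ _ /(_ x) + _.
by case: (ip x x) => a b; rewrite lecE /= => /andP[/eqP ->].
Qed.

Lemma nsq_ge0 x : 0 <= nsq x.
Proof. by rewrite -ler0c -sqnormE; case: hip => _ _ pos _; exact: pos. Qed.

Lemma nsq_eq0 x : nsq x = 0 -> x = 0.
Proof.
by move=> x0; case: hip => _ _ _; apply; have := sqnormE x; rewrite x0.
Qed.

Lemma nsq0 : nsq 0 = 0.
Proof. by rewrite /nsq /rip ip0l. Qed.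

Lemma nsqD x y : nsq (x + y) = nsq x + 2 * rip x y + nsq y.
Proof. by rewrite /nsq ripDl !ripDr (ripC y x); lra. Qed.

Lemma nsqB x y : nsq (x - y) = nsq x - 2 * rip x y + nsq y.
Proof. by rewrite /nsq ripBl !ripBr (ripC y x); lra. Qed.

Lemma nsqN x : nsq (- x) = nsq x.
Proof. by rewrite -[- x]sub0r nsqB nsq0 /rip ip0l /= ; lra. Qed.

Lemma nsqBC x y : nsq (x - y) = nsq (y - x).
Proof. by rewrite -nsqN opprB. Qed.

Lemma parallelogram x y : nsq (x + y) + nsq (x - y) = 2 * nsq x + 2 * nsq y.
Proof. by rewrite nsqD nsqB; lra. Qed.

Lemma nsqD_le x y : nsq (x + y) <= 2 * nsq x + 2 * nsq y.
Proof. by rewrite -parallelogram lerDl nsq_ge0. Qed.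

(** This replaces the triangle inequality for squared norms; two errors of [e / 4] add up to [e]. *)
Lemma nsq_dist_le y x z : nsq (x - z) <= 2 * nsq (x - y) + 2 * nsq (y - z).
Proof. by rewrite (_ : x - z = (x - y) + (y - z)) ?nsqD_le// addrA subrK. Qed.

Definition cabs2 (c : R[i]) : R := complex.Re c ^+ 2 + complex.Im c ^+ 2.

Lemma nsqZ c x : nsq (c *: x) = cabs2 c * nsq x.
Proof.
have cc : ip (c *: x) (c *: x) = c * (c^*)%R * ip x x.
  rewrite ipZl; case: hip => _ sym _ _.
  by rewrite sym ipZl rmorphM /= -mulrA -sym.
have := sqnormE x; have := sqnormE (c *: x); rewrite /Defs.sqnorm cc => + e.
rewrite e => e'; apply: complexI; rewrite -e'.
case: c {cc e'} => a b; rewrite /cabs2 /=.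
apply/eqP; rewrite eq_complex /=; apply/andP; split; apply/eqP; ring.
Qed.

Lemma nsqZr (c : R) x : nsq (c%:C%C *: x) = c ^+ 2 * nsq x.
Proof. by rewrite nsqZ /cabs2 /= expr0n addr0. Qed.

Lemma cauchy_schwarz x y : rip x y ^+ 2 <= nsq x * nsq y.
Proof.
have [y0|yn0] := eqVneq (nsq y) 0.
  by rewrite (nsq_eq0 _ y0) ripC /rip ip0l nsq0 /= expr0n mulr0.
have ypos : 0 < nsq y by rewrite lt_def yn0 nsq_ge0.
(* The coefficient minimises the distance from [x] to the real multiples of [y]. *)
have := nsq_ge0 (x - (rip x y / nsq y)%:C%C *: y).
rewrite nsqB nsqZr ripZr => h.
rewrite -subr_ge0 (_ : _ - _ = nsq y *
  (nsq x - 2 * (rip x y / nsq y * rip x y) + (rip x y / nsq y) ^+ 2 * nsq y)).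
  by rewrite mulr_ge0// nsq_ge0.
by field.
Qed.

Lemma nsq_arbitrarily_small x : (forall e : R, 0 < e -> nsq x <= e) -> x = 0.
Proof.
move=> xe; apply: nsq_eq0; apply/eqP; rewrite eq_le nsq_ge0 andbT.
by apply/ler_addgt0Pr => e /xe; rewrite add0r.
Qed.

Lemma sqnorm_lt e x : 0 < e -> (sqnorm x < e) = (nsq x < complex.Re e).
Proof.
by move=> e0; rewrite sqnormE; case: e e0 => a b; rewrite !ltcE /= => /andP[->].
Qed.

Lemma Re_gt0 (e : R[i]) : 0 < e -> 0 < complex.Re e.
Proof. by case: e => a b; rewrite ltcE /= => /andP[]. Qed.

Section Projections.
Variable P : H -> H.
Hypothesis hP : is_projection P.

Lemma projectionD x y : P (x + y) = P x + P y.
Proof. by case: hP => lin _ _ _; have := lin 1 x y; rewrite !scale1r. Qed.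

Lemma projection0 : P 0 = 0.
Proof. by have /esym/eqP := projectionD 0 0; rewrite addr0 -subr_eq0 addrK => /eqP. Qed.

Lemma projectionZ c x : P (c *: x) = c *: P x.
Proof. by case: hP => lin _ _ _; have := lin c x 0; rewrite projection0 !addr0. Qed.

Lemma projectionB x y : P (x - y) = P x - P y.
Proof. by rewrite projectionD -scaleN1r projectionZ scaleN1r. Qed.

Lemma projectionK x : P (P x) = P x. Proof. by case: hP. Qed.

Lemma projection_rip x y : rip (P x) y = rip x (P y).
Proof. by case: hP => _ _ _ sa; rewrite /rip sa. Qed.

Lemma range_projection x : range P x <-> P x = x.
Proof. by split => [[y _ <-]|<-]; [rewrite projectionK|exists x]. Qed.

Lemma projection_nsq x : nsq (P x) = rip (P x) x.
Proof. by rewrite /nsq -projection_rip projectionK. Qed.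

Lemma projection_pythagoras x : nsq x = nsq (P x) + nsq (x - P x).
Proof. by rewrite nsqB (ripC x) -projection_nsq; lra. Qed.

Lemma projection_le x : nsq (P x) <= nsq x.
Proof. by rewrite [leRHS]projection_pythagoras lerDl nsq_ge0. Qed.

End Projections.

(** * Closed subspaces and the projections onto them *)

Definition closed_subspace (V : set H) :=
  [/\ V 0, (forall c x y, V x -> V y -> V (c *: x + y)) &
      (forall x, (forall e : R, 0 < e -> exists2 y, V y & nsq (y - x) < e) -> V x)].

Lemma closed_subspaceD {V} : closed_subspace V -> forall x y, V x -> V y -> V (x + y).
Proof. by move=> [_ lin _] x y Vx Vy; rewrite -[x]scale1r; exact: lin. Qed.

Lemma closed_subspaceZ {V} : closed_subspace V -> forall c x, V x -> V (c *: x).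
Proof. by move=> [V0 lin _] c x Vx; rewrite -[_ *: _]addr0; exact: lin. Qed.

Lemma closed_subspaceB {V} : closed_subspace V -> forall x y, V x -> V y -> V (x - y).
Proof.
move=> cV x y Vx Vy; rewrite -scaleN1r.
by apply: (closed_subspaceD cV) => //; exact: (closed_subspaceZ cV).
Qed.

Lemma range_closed_subspace P : is_projection P -> closed_subspace (range P).
Proof.
move=> hP; split.
- by apply/range_projection => //; exact: projection0.
- move=> c x y /(range_projection _ hP) xP /(range_projection _ hP) yP.
  apply/range_projection => //.
  by case: hP => lin _ _ _; rewrite lin xP yP.
- move=> x xe; apply/range_projection => //; apply/eqP; rewrite -subr_eq0; apply/eqP.
  apply: nsq_arbitrarily_small => e e0.
  have [|y /(range_projection _ hP) yP yx] := xe (e / 4); first by rewrite divr_gt0.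
  apply: le_trans (nsq_dist_le y _ _) _; rewrite -{1}yP -projectionB//.
  have := projection_le _ hP (x - y); rewrite (nsqBC x y); lra.
Qed.

(** Equal ranges give [QP = P] and [PQ = Q]; moving the operators across the inner product then
    makes the squared norm of [P x - Q x] vanish. *)
Lemma projection_unique P Q : is_projection P -> is_projection Q ->
  range P = range Q -> P = Q.
Proof.
move=> hP hQ PQ; apply/funext => x.
have QP y : Q (P y) = P y.
  by apply/range_projection => //; rewrite -PQ; exists y.
have PQ' y : P (Q y) = Q y.
  by apply/range_projection => //; rewrite PQ; exists y.
apply/eqP; rewrite -subr_eq0; apply/eqP; apply: nsq_eq0.
rewrite /nsq; set z := P x - Q x; rewrite {1}/z ripBl -QP.
rewrite (projection_rip _ hQ) (projection_rip _ hP) (projection_rip _ hQ).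
by rewrite PQ' subrr.
Qed.

Hypothesis hcomplete : is_complete R H ip.

Lemma nearest_point_orthogonal V x : closed_subspace V ->
  exists2 v, V v & forall w, V w -> rip (x - v) w = 0.
Proof.
move=> cV; have [V0 Vlin Vcl] := cV.
pose E := [set nsq (x - v) | v in V].
have E0 : E !=set0 by exists (nsq (x - 0)); exists 0.
have Elb : has_lbound E by exists 0 => _ [v _ <-]; exact: nsq_ge0.
have hE : has_inf E by [].
pose d := inf E.
have dle v : V v -> d <= nsq (x - v) by move=> Vv; apply: ge_inf => //; exists v.
have app n : {v | V v /\ nsq (x - v) < d + n.+1%:R^-1}.
  apply: cid; have [|_ [v Vv <-] vd] := @inf_adherent _ E n.+1%:R^-1 _ hE.
    by rewrite invr_gt0 ltr0n.
  by exists v.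
pose u n := sval (app n).
have Vu n : V (u n) by have [] := svalP (app n).
have uu n k : nsq (u n - u k) <= 2 * (n.+1%:R^-1 + k.+1%:R^-1).
  (* The midpoint is at squared distance at least [d] from [x], so the parallelogram law forces the
     minimising sequence to be Cauchy. *)
  have mid : V (((2^-1 : R)%:C%C) *: (u n + u k)).
    by apply: (closed_subspaceZ cV); exact: (closed_subspaceD cV).
  have := dle _ mid; have := (svalP (app n)).2; have := (svalP (app k)).2.
  rewrite -/(u n) -/(u k).
  have := parallelogram (x - u n) (x - u k).
  rewrite (_ : x - u n - (x - u k) = u k - u n); last first.
    by rewrite opprB addrC addrA subrK.
  rewrite (_ : x - u n + (x - u k) = (2%:R : R)%:C%C *: (x - (2^-1 : R)%:C%C *: (u n + u k))).
    rewrite nsqZr (nsqBC (u k)).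
    by move: (n.+1%:R^-1 : R) (k.+1%:R^-1 : R) => a b h1 h2 h3 h4; lra.
  rewrite scalerBr scalerA -rmorphM /= mulfV ?pnatr_eq0// scale1r.
  by rewrite (_ : (2%:R : R)%:C%C = 2%:R) ?rmorph_nat// scaler_nat mulr2n opprD addrACA.
have small (e : R) : 0 < e -> exists N, forall n, (N <= n)%N -> n.+1%:R^-1 < e.
  move=> e0; exists (Num.bound e^-1) => n Nn.
  rewrite -[e]invrK ltf_pV2 ?posrE ?ltr0n ?invr_gt0//.
  apply: lt_le_trans (archi_boundP _) _; first by rewrite invr_ge0 ltW.
  by rewrite ler_nat ltnW.
have [v uv] : exists v, seq_cvg R H ip u v.
  apply: hcomplete => e e0.
  have [|N hN] := small (complex.Re e / 4); first by rewrite divr_gt0// Re_gt0.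
  exists N => n k Nn Nk; rewrite sqnorm_lt//.
  have := hN _ Nn; have := hN _ Nk; have := uu n k.
  by move: (n.+1%:R^-1 : R) (k.+1%:R^-1 : R) => a b h1 h2 h3; lra.
have cv (e : R) : 0 < e -> exists N, forall n, (N <= n)%N -> nsq (u n - v) < e.
  move=> e0; have [|N hN] := uv e%:C%C; first by rewrite ltcR.
  by exists N => n /hN; rewrite sqnorm_lt ?ltcR.
exists v.
  by apply: Vcl => e /cv[N hN]; exists (u N) => //; exact: hN.
move=> w Vw.
(* [d <= |x - u n - t w|^2] for all real [t], so [(rip (x - u n) w)^2 <= |w|^2/(n+1)] *)
have orth n : rip (x - u n) w ^+ 2 <= n.+1%:R^-1 * nsq w.
  have [w0|wn0] := eqVneq (nsq w) 0.
    by rewrite (nsq_eq0 _ w0) ripC /rip ip0l nsq0 /= expr0n mulr0.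
  have wpos : 0 < nsq w by rewrite lt_def wn0 nsq_ge0.
  set r := rip (x - u n) w.
  have Vs : V ((r / nsq w)%:C%C *: w + u n) by exact: Vlin.
  have := dle _ Vs; rewrite opprD addrA addrAC nsqB nsqZr ripZr -/r.
  have := (svalP (app n)).2; rewrite -/(u n) => h1 h2.
  have h3 : 0 <= n.+1%:R^-1 - 2 * (r / nsq w * r) + (r / nsq w) ^+ 2 * nsq w.
    by move: (n.+1%:R^-1 : R) h1 h2 => a h1 h2; lra.
  move: (n.+1%:R^-1 : R) h3 => a h3.
  rewrite -subr_ge0 (_ : _ - _ = nsq w *
    (a - 2 * (r / nsq w * r) + (r / nsq w) ^+ 2 * nsq w)).
    by rewrite mulr_ge0// nsq_ge0.
  by field.
apply/eqP; rewrite -sqrf_eq0 eq_le sqr_ge0 andbT; apply/ler_addgt0Pr => e e0.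
(* Adding 1 keeps [W] positive when [w = 0]; errors below [e / (4 * W)] become at most [e / 4] after
   multiplication by [nsq w]. *)
rewrite add0r; pose W := nsq w + 1; have W0 : 0 < W by have := nsq_ge0 w; rewrite /W; lra.
have e4 : 0 < e / (4 * W) by rewrite divr_gt0// mulr_gt0.
have [N1 hN1] := small _ e4; have [N2 hN2] := cv _ e4.
pose n := maxn N1 N2.
have a1 := hN1 n (leq_maxl _ _); have a2 := hN2 n (leq_maxr _ _).
have -> : x - v = (x - u n) + (u n - v) by rewrite addrA subrK.
rewrite ripDl.
have b1 := orth n; have b2 := cauchy_schwarz (u n - v) w.
have c1 : n.+1%:R^-1 * nsq w <= e / 4.
  apply: (@le_trans _ _ (e / (4 * W) * W)).
    by apply: ler_pM; rewrite ?nsq_ge0 ?ltW// ?invr_gt0 ?ltr0n// /W; lra.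
  by rewrite le_eqVlt; apply/orP; left; apply/eqP; field; rewrite gt_eqF.
have c2 : nsq (u n - v) * nsq w <= e / 4.
  apply: (@le_trans _ _ (e / (4 * W) * W)).
    by apply: ler_pM; rewrite ?nsq_ge0 ?ltW// /W; lra.
  by rewrite le_eqVlt; apply/orP; left; apply/eqP; field; rewrite gt_eqF.
move: (le_trans b1 c1) (le_trans b2 c2); clear.
move: (rip (x - u n) w) (rip (u n - v) w) => a b ha hb.
(* Nonnegativity of the square of [a - b] gives [(a + b)^2 <= 2 a^2 + 2 b^2 <= e]. *)
by have := sqr_ge0 (a - b); rewrite sqrrB sqrrD; move: (a * b) ha hb => ab; lra.
Qed.

Lemma projection_exists V : closed_subspace V ->
  exists P, is_projection P /\ range P = V.
Proof.
move=> cV; have [V0 Vlin _] := cV.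
have pt x : {v | V v /\ forall w, V w -> rip (x - v) w = 0}.
  by apply: cid; have [v] := nearest_point_orthogonal V x cV; exists v.
pose P x := sval (pt x).
have PV x : V (P x) by have [] := svalP (pt x).
have Po x w : V w -> rip (x - P x) w = 0 by have [_] := svalP (pt x); apply.
(* The nearest point is the only point of [V] with residual orthogonal to [V]; linearity of [P] will
   follow from this. *)
have uniq x v : V v -> (forall w, V w -> rip (x - v) w = 0) -> P x = v.
  move=> Vv vo; apply/eqP; rewrite -subr_eq0; apply/eqP; apply: nsq_eq0.
  have Vd : V (P x - v) by exact: (closed_subspaceB cV).
  have := Po x _ Vd; have := vo _ Vd; rewrite /nsq !ripBl; lra.
have Pid x : V x -> P x = x.
  by move=> Vx; apply: uniq => // w _; rewrite subrr /rip ip0l.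
(* Testing also against ['i%C *: w] upgrades real orthogonality to complex orthogonality. *)
have Porth x w : V w -> ip (x - P x) w = 0.
  move=> Vw; rewrite -[RHS](ip0l w); apply: ip_eq_rip; first by rewrite Po// /rip ip0l.
  rewrite scaler0 [RHS]/rip ip0l /= /rip ipZl.
  have := Po x _ (closed_subspaceZ cV 'i%C w Vw); rewrite ripC /rip ipZl.
  case: hip => _ sym _ _; rewrite (sym (x - P x) w).
  case: (ip (x - P x) w) => a b /=; lra.
have Plin : is_linear_op R H P.
  move=> c x y; apply: uniq; first exact: Vlin.
  move=> w Vw; rewrite opprD addrACA -scalerBr ripDl Po// addr0 /rip ipZl.
  by rewrite Porth// mulr0.
have Psa x y : ip (P x) y = ip x (P y).
  have e1 : ip (P x) y = ip (P x) (P y).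
    case: hip => _ sym _ _; rewrite sym [RHS]sym; congr (_^*).
    have := Porth y _ (PV x); rewrite ipDl => /eqP.
    by rewrite -scaleN1r ipZl mulN1r subr_eq0 => /eqP.
  rewrite e1; have := Porth x _ (PV y); rewrite ipDl => /eqP.
  by rewrite -scaleN1r ipZl mulN1r subr_eq0 => /eqP.
exists P; split; last first.
  by apply/seteqP; split => [_ [x _ <-]//|x Vx]; exists x => //; exact: Pid.
split => //.
- exists 1 => x; rewrite mul1r !sqnormE lecR.
  have -> : nsq x = nsq (P x) + 2 * rip (P x) (x - P x) + nsq (x - P x).
    by rewrite -nsqD addrC subrK.
  by rewrite ripC Po// mulr0 addr0 lerDl nsq_ge0.
- by move=> x; exact: Pid.
Qed.

Local Notation proj := (proj R H ip).

Lemma projP V : closed_subspace V -> is_projection (proj V) /\ range (proj V) = V.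
Proof. by move=> /projection_exists exP; exact: epsilon_spec exP. Qed.

Lemma proj_id V x : closed_subspace V -> proj V x = x <-> V x.
Proof.
by move=> /projP[hP rP]; rewrite -(range_projection _ hP) rP.
Qed.

Lemma proj_in V x : closed_subspace V -> V (proj V x).
Proof. by move=> /projP[_ rP]; rewrite -[X in X _]rP; exists x. Qed.

(** The difference of the two candidates lies in [V] and is orthogonal to [V], hence to itself. *)
Lemma proj_char V x y : closed_subspace V -> V y ->
  (forall w, V w -> rip (x - y) w = 0) -> proj V x = y.
Proof.
move=> cV Vy xy; have [hP _] := projP V cV.
have Vd : V (proj V x - y) by apply: (closed_subspaceB cV) => //; exact: proj_in.
apply/eqP; rewrite -subr_eq0; apply/eqP; apply: nsq_eq0.
have := xy _ Vd; rewrite /nsq !ripBl projection_rip//.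
move: Vd => /(proj_id _ _ cV) ->; lra.
Qed.

Lemma proj_projection P V : is_projection P -> range P = V -> proj V = P.
Proof.
move=> hP rP; have cV := range_closed_subspace _ hP.
rewrite -rP; have [h1 h2] := projP _ cV.
exact: projection_unique.
Qed.

(* If [P] leaves [W] invariant then [P proj_W] is self-adjoint, so they commute. *)
Lemma proj_commute P W : is_projection P -> closed_subspace W ->
  (forall x, W x -> W (P x)) -> forall x, P (proj W x) = proj W (P x).
Proof.
move=> hP cW PW x; have [hQ _] := projP W cW.
have QPQ y : proj W (P (proj W y)) = P (proj W y).
  by apply/proj_id => //; apply: PW; exact: proj_in.
apply/eqP; rewrite -subr_eq0; apply/eqP; apply: nsq_eq0.
rewrite /nsq; set z := P _ - _; rewrite {1}/z ripBl -QPQ.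
rewrite (projection_rip _ hQ) (projection_rip _ hP) (projection_rip _ hQ) QPQ.
by rewrite (projection_rip _ hQ) (projection_rip _ hP) subrr.
Qed.

(** Commuting projections compose to a projection, whose range consists of the vectors fixed by
    both. *)
Lemma proj_comp P W : is_projection P -> closed_subspace W ->
  (forall x, W x -> W (P x)) -> proj (range P `&` W) = (fun x => P (proj W x)).
Proof.
move=> hP cW PW; have [hQ rQ] := projP W cW.
have comm := proj_commute P W hP cW PW.
apply: proj_projection.
- split.
  + by move=> c x y; case: hQ => -> _ _ _; case: hP => ->.
  + exists 1 => x; rewrite mul1r !sqnormE lecR.
    by apply: le_trans (projection_le _ hP _) (projection_le _ hQ _).
  + by move=> x; rewrite -comm !projectionK.
  + move=> x y; rewrite comm; case: hQ => _ _ _ ->; case: hP => _ _ _ ->.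
    by rewrite comm.
- apply/seteqP; split => [_ [x _ <-]|x [/(range_projection _ hP) xP /(proj_id _ _ cW) xW]].
    by split; [exists (proj W x)|rewrite comm; exact: proj_in].
  by exists x => //; rewrite xW.
Qed.

(** * Strong sums of operators *)

Section StrongSums.
Variables (D : countType) (Q : set D) (f : D -> H -> H) (S : H -> H).
Hypothesis hsum : strong_sum_on R H ip D Q f S.

Lemma strong_sum_approx x (e : R) : 0 < e ->
  exists F0 : {fset D}, (forall a, a \in F0 -> Q a) /\
    forall F : {fset D}, (F0 `<=` F)%fset -> (forall a, a \in F -> Q a) ->
      nsq (\sum_(a <- F) f a x - S x) < e.
Proof.
move=> e0; have eC : 0 < e%:C%C by rewrite ltcR.
have [F0 [QF0 hF]] := hsum x _ eC; exists F0; split => // F F0F QF.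
by have := hF _ F0F QF; rewrite sqnorm_lt.
Qed.

Lemma strong_sum_closed V x : closed_subspace V ->
  (forall a, Q a -> V (f a x)) -> V (S x).
Proof.
move=> cV Vf; have [V0 _ Vc] := cV; apply: Vc => e e0.
have [F0 [QF0 hF]] := strong_sum_approx x e e0.
exists (\sum_(a <- F0) f a x); last exact: hF.
rewrite big_seq; apply: big_ind => //; first exact: (closed_subspaceD cV).
by move=> a /QF0; exact: Vf.
Qed.

Lemma strong_sum_commute P x : is_projection P ->
  (forall a, Q a -> P (f a x) = f a (P x)) -> P (S x) = S (P x).
Proof.
move=> hP comm; apply/eqP; rewrite -subr_eq0; apply/eqP.
apply: nsq_arbitrarily_small => e e0.
have e4 : 0 < e / 4 by rewrite divr_gt0.
have [F1 [QF1 hF1]] := strong_sum_approx x _ e4.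
have [F2 [QF2 hF2]] := strong_sum_approx (P x) _ e4.
(* The union of the two finite sets serves both approximations, at [x] and at [P x], with the same
   partial sum. *)
have QF a : a \in (F1 `|` F2)%fset -> Q a by rewrite in_fsetU => /orP[/QF1|/QF2].
have h1 := hF1 _ (fsubsetUl F1 F2) QF; have h2 := hF2 _ (fsubsetUr F1 F2) QF.
apply: le_trans (nsq_dist_le (P (\sum_(a <- (F1 `|` F2)%fset) f a x)) _ _) _.
rewrite -projectionB//; have := projection_le _ hP (S x - \sum_(a <- (F1 `|` F2)%fset) f a x).
rewrite (nsqBC (S x)).
suff -> : P (\sum_(a <- (F1 `|` F2)%fset) f a x) = \sum_(a <- (F1 `|` F2)%fset) f a (P x).
  by lra.
rewrite (big_morph P (projectionD _ hP) (projection0 _ hP)) big_seq [RHS]big_seq.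
by apply: eq_bigr => a /QF; exact: comm.
Qed.

(** For a projection, [nsq (f a x)] equals [rip (f a x) x], which is linear in the operator. Strong
    convergence of the sum therefore passes to these numbers by Cauchy-Schwarz. *)
Lemma strong_sum_nsq x : (forall a, is_projection (f a)) -> is_projection S ->
  \esum_(a in Q) (nsq (f a x))%:E = (nsq (S x))%:E.
Proof.
move=> hf hS.
have sumE (F : {fset D}) : \sum_(a <- F) nsq (f a x) = rip (\sum_(a <- F) f a x) x.
  have r0 : rip 0 x = 0 by rewrite /rip ip0l.
  rewrite (big_morph (rip^~ x) (fun u v => ripDl u v x) r0).
  by apply: eq_bigr => a _; rewrite projection_nsq.
have app (e : R) : 0 < e -> exists F0 : {fset D}, (forall a, a \in F0 -> Q a) /\
    forall F : {fset D}, (F0 `<=` F)%fset -> (forall a, a \in F -> Q a) ->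
    `|\sum_(a <- F) nsq (f a x) - nsq (S x)| <= e.
  move=> e0; have W0 : 0 < nsq x + 1 by have := nsq_ge0 x; lra.
  (* With this error, Cauchy-Schwarz bounds the square of the difference by [e ^+ 2]. *)
  have [|F0 [QF0 hF]] := strong_sum_approx x (e ^+ 2 / (nsq x + 1)).
    by rewrite divr_gt0// exprn_gt0.
  exists F0; split => // F F0F QF.
  rewrite sumE projection_nsq// -ripBl -(@ler_pXn2r _ 2) ?nnegrE// ?(ltW e0)//.
  rewrite real_normK ?num_real//; apply: le_trans (cauchy_schwarz _ _) _.
  apply: (@le_trans _ _ (e ^+ 2 / (nsq x + 1) * (nsq x + 1))).
    by apply: ler_pM; rewrite ?nsq_ge0// ?ltW ?hF//; lra.
  by rewrite divfK// gt_eqF.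
apply/eqP; rewrite eq_le; apply/andP; split.
- apply: ge_ereal_sup => _ [X [finX XQ] <-].
  rewrite fsbig_finite//= sumEFin lee_fin; apply/ler_addgt0Pr => e e0.
  have [F0 [QF0 hF]] := app e e0.
  (* The approximation applies once the finite set is enlarged by [F0], and the added terms are
     nonnegative. *)
  have QU a : a \in (fset_set X `|` F0)%fset -> Q a.
    by rewrite in_fsetU => /orP[|/QF0//]; rewrite in_fset_set// inE => /XQ.
  have := hF _ (fsubsetUr _ F0) QU; rewrite ler_distl => /andP[_]; apply: le_trans.
  rewrite [leRHS](big_fsetID _ (mem (fset_set X)))/=.
  rewrite (_ : [fset a in _ | _]%fset = fset_set X); last first.
    by apply/fsetP => a; rewrite !inE andbC; case: (a \in fset_set X).
  by rewrite lerDl sumr_ge0// => a _; exact: nsq_ge0.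
- apply/lee_addgt0Pr => e e0; have [F0 [QF0 hF]] := app e e0.
  have := hF F0 (fsubset_refl _) QF0; rewrite ler_distl => /andP[h _].
  apply: (@le_trans _ _ ((\sum_(a <- F0) nsq (f a x))%:E + e%:E)%E).
    by rewrite -EFinD lee_fin; lra.
  rewrite leeD2r//; apply: esum_ge; exists [set` F0].
    by split; [exact: finite_fset|move=> a /= /QF0].
  by rewrite fsbig_finite//= set_fsetK sumEFin.
Qed.

End StrongSums.

End InnerProduct.

(** * Commuting families of projections and their refinements *)

Section CommutingFamilies.
Variables (R : realType) (H : lmodType R[i]) (ip : H -> H -> R[i]).
Hypothesis hH : is_hilbert R H ip.
Let hip : is_inner_product R H ip := proj1 hH.
Let hcompl : is_complete R H ip := proj2 hH.
Local Notation nsq := (nsq R H ip).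
Local Notation rip := (rip R H ip).
Local Notation is_projection := (is_projection R H ip).
Local Notation closed_subspace := (closed_subspace R H ip).
Local Notation prod_ops := (prod_ops R H).

Lemma prod_ops_app l1 l2 x : prod_ops (l1 ++ l2) x = prod_ops l1 (prod_ops l2 x).
Proof. by elim: l1 => //= W l ->. Qed.

Lemma prod_ops_linear l : List.Forall is_projection l -> is_linear_op R H (prod_ops l).
Proof. by elim=> [|W l' [lin _ _ _] _ IH] c x y //=; rewrite IH lin. Qed.

Lemma prod_ops_le l : List.Forall is_projection l -> forall x, nsq (prod_ops l x) <= nsq x.
Proof.
elim=> [|W l' hW _ IH] x //=; exact: le_trans (projection_le _ _ _ hip _ hW _) (IH x).
Qed.

Lemma prod_ops_commute P l x :
  (forall W, In W l -> forall y, P (W y) = W (P y)) -> P (prod_ops l x) = prod_ops l (P x).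
Proof.
elim: l => //= W l IH comm; rewrite comm; last by left.
by rewrite IH// => V lV; apply: comm; right.
Qed.

Lemma id_projection : is_projection id.
Proof. by split => //; exists 1 => x; rewrite mul1r. Qed.

Section Family.
Variables (T : Type) (Delta : T -> countType) (p : forall t, Delta t -> H -> H).
Hypothesis hp : is_pvm_family R H ip T Delta p.
Local Notation in_family := (in_family R H T Delta p).
Local Notation H_comm := (H_comm R H T Delta p).
Local Notation proj_of := (proj_of R H ip T Delta p).
Local Notation cyl := (cyl_of T Delta).
Local Notation Sig := (Sigma T Delta).
Local Notation ops := (map (fun i : Defs.index T Delta => p (projT1 i) (projT2 i))).

Lemma family_projection l : List.Forall in_family l -> List.Forall is_projection l.
Proof.
by apply: List.Forall_impl => W [t [a ->]]; case: hp.
Qed.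

Lemma ops_in_family l : List.Forall in_family (ops l).
Proof.
apply/List.Forall_forall => W /List.in_map_iff[[t a] [<- _]].
by exists t, a.
Qed.

(** Products of projections are linear and do not increase norms, so an equality between two of them
    survives linear combinations and limits. *)
Lemma H_comm_closed_subspace : closed_subspace H_comm.
Proof.
split.
- move=> l1 l2 h12 perm.
  have hl l : List.Forall in_family l -> prod_ops l 0 = 0.
    elim=> // W l' [t [a ->]] _ /= ->; apply: (projection0 _ _ ip).
    by case: hp.
  by rewrite !hl//; exact: Permutation_Forall perm h12.
- move=> c x y hx hy l1 l2 h12 perm.
  have h2 := Permutation_Forall perm h12.
  rewrite !prod_ops_linear ?(hx l1 l2) ?(hy l1 l2)//; exact: family_projection.
- move=> x xe l1 l2 h12 perm.
  have h1 := family_projection _ h12.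
  have h2 := family_projection _ (Permutation_Forall perm h12).
  have sub l y z : List.Forall is_projection l ->
      prod_ops l (y - z) = prod_ops l y - prod_ops l z.
    by move=> hl; rewrite addrC -scaleN1r prod_ops_linear// scaleN1r addrC.
  apply/eqP; rewrite -subr_eq0; apply/eqP.
  apply: (nsq_arbitrarily_small _ _ _ hip) => e e0.
  have [|y Hy yx] := xe (e / 4); first by rewrite divr_gt0.
  apply: le_trans (nsq_dist_le _ _ _ hip (prod_ops l1 y) _ _) _.
  rewrite -sub// (Hy l1 l2)// -sub//.
  have := prod_ops_le _ h1 (x - y); have := prod_ops_le _ h2 (y - x).
  rewrite (nsqBC _ _ _ hip x y); lra.
Qed.

Lemma H_comm_stable t (a : Delta t) x : H_comm x -> H_comm (p t a x).
Proof.
move=> hx l1 l2 h12 perm.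
have := hx (l1 ++ p t a :: nil)%list (l2 ++ p t a :: nil)%list; rewrite !prod_ops_app; apply.
  by apply/Forall_app; split => //; constructor => //; exists t, a.
exact: Permutation_app_tail.
Qed.

Lemma H_comm_swap t (a : Delta t) s (b : Delta s) x : H_comm x ->
  p t a (p s b x) = p s b (p t a x).
Proof.
move=> /(_ (p t a :: p s b :: nil) (p s b :: p t a :: nil)); apply.
  by constructor; [exists t, a|constructor; [exists s, b|constructor]].
exact: perm_swap.
Qed.

(** Permutations are generated by adjacent swaps, and stability of [K] lets a swap take place in
    front of an already applied product. This gives a criterion involving only pairs of
    projections. *)
Lemma sub_H_comm (K : set H) :
  (forall t (a : Delta t) x, K x -> K (p t a x)) ->
  (forall t (a : Delta t) s (b : Delta s) x, K x -> p t a (p s b x) = p s b (p t a x)) ->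
  K `<=` H_comm.
Proof.
move=> stab swap x Kx l1 l2 + perm.
have Kl l : List.Forall in_family l -> K (prod_ops l x).
  by elim=> // W l' [t [a ->]] _ /=; exact: stab.
elim: perm => {l1 l2} //.
- by move=> W l l' _ IH /List.Forall_cons_iff[_ hl] /=; rewrite IH.
- move=> W V l /List.Forall_cons_iff[[t [a ->]] /List.Forall_cons_iff[[s [b ->]] hl]] /=.
  by rewrite swap//; exact: Kl.
- move=> l1 l2 l3 p12 IH12 p23 IH23 h1.
  by rewrite IH12// IH23//; exact: Permutation_Forall p12 h1.
Qed.

Lemma pmeet_closed_subspace l : List.Forall is_projection l ->
  closed_subspace (fun x => forall P, In P l -> range P x).
Proof.
move=> /List.Forall_forall hl; split.
- by move=> P /hl /(range_closed_subspace _ _ _ hip)[].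
- move=> c x y hx hy P lP; have [_ + _] := range_closed_subspace _ _ _ hip P (hl _ lP).
  by apply; [exact: hx|exact: hy].
- move=> x xe P lP; have [_ _] := range_closed_subspace _ _ _ hip P (hl _ lP).
  by apply => e /xe[y hy yx]; exists y => //; exact: hy.
Qed.

Let ops_proj l := family_projection _ (ops_in_family l).

Lemma proj_of_projection l : is_projection (proj_of l).
Proof.
exact: (proj1 (projP _ _ _ hip hcompl _ (pmeet_closed_subspace _ (ops_proj l)))).
Qed.

(** On [H_comm] any factor can be moved to the front, so the product lies in every range. Against a
    vector [w] fixed by all factors, self-adjointness removes them one by one, so the residual is
    orthogonal to the intersection. *)
Lemma proj_of_prod l x : H_comm x -> proj_of l x = prod_ops (ops l) x.
Proof.
move=> hx; apply: (proj_char _ _ _ hip hcompl).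
- exact: pmeet_closed_subspace (ops_proj l).
- move=> P lP; have [l1 [l2 e]] := List.in_split _ _ lP.
  rewrite (hx _ (P :: (l1 ++ l2))%list (ops_in_family l)); first by exists (prod_ops (l1 ++ l2)%list x).
  by rewrite e; apply: Permutation_sym; exact: Permutation_middle.
- move=> w hw; rewrite (ripBl _ _ _ hip).
  suff -> : rip (prod_ops (ops l) x) w = rip x w by rewrite subrr.
  have := ops_proj l; elim: (ops l) hw => //= P l' IH hw /List.Forall_cons_iff[hP hl'].
  rewrite (projection_rip _ _ _ _ hP).
  have /(range_projection _ _ _ _ hP) -> := hw P (or_introl erefl).
  by apply: IH => // Q lQ; apply: hw; right.
Qed.

Lemma proj_of_cons t (a : Delta t) l x : H_comm x ->
  proj_of (existT _ t a :: l) x = p t a (proj_of l x).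
Proof. by move=> hx; rewrite !proj_of_prod. Qed.

Lemma proj_of_ext l l' : (forall i, In i l <-> In i l') -> proj_of l = proj_of l'.
Proof.
move=> ll'; rewrite /Defs.proj_of /pmeet_list; congr (proj R H ip _).
apply/funext => x; apply/propext; split => h P /List.in_map_iff[i [<- /ll' il]];
  by apply: h; apply/List.in_map_iff; exists i.
Qed.

(* The measure [B |-> |x|^2 * P_x(B)] of the paper, left unnormalised so that
   it is defined at [x = 0] and quadratic in [x]. *)
Definition spectral (x : H) (mu : set (Omega T Delta) -> \bar R) :=
  fin_measure_on R (Omega T Delta) Sig mu /\ forall l, mu (cyl l) = (nsq (proj_of l x))%:E.

(** Consistency of the cylinder masses is Parseval's identity for the resolution of the identity at
    [t], applied to [proj_of l x]. *)
Lemma spectral_exists x : H_comm x -> exists mu, spectral x mu.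
Proof.
move=> hx; apply: kolmogorov_extension.
- by move=> l; exact: nsq_ge0.
- by move=> l l' ll'; rewrite (proj_of_ext l l').
- move=> t l; rewrite -[RHS](strong_sum_nsq _ _ _ hip _ _ _ _ (proj2 hp t)).
  + by apply: eq_esum => a _; rewrite proj_of_cons.
  + by case: hp => h _ a; exact: h.
  + exact: id_projection.
Qed.

Lemma cyl_nil : cyl nil = setT.
Proof. by apply/seteqP; split => // w _ i []. Qed.

Lemma cyl_cons t (a : Delta t) l :
  cyl (existT _ t a :: l) = [set w | w t = a] `&` cyl l.
Proof.
apply/seteqP; split => [w hw|w [wt wl] i /= [<-//|]]; last exact: wl.
split; first exact: (hw (existT _ t a) (or_introl erefl)).
by move=> i li; apply: hw; right.
Qed.

Lemma Sigma_coord t (a : Delta t) : Sig [set w | w t = a].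
Proof. by apply: sub_sigma_algebra; exists t, a. Qed.

Lemma Sigma_cyl l : Sig (cyl l).
Proof.
elim: l => [|[t a] l IH]; first by rewrite cyl_nil; exact: sigma_setT.
by rewrite cyl_cons; apply: sigma_setI => //; exact: Sigma_coord.
Qed.

(** Cylinders are closed under intersection, by concatenation of their lists, and they generate
    [Sig]. *)
Lemma cyl_unique mu nu : fin_measure_on R _ Sig mu -> fin_measure_on R _ Sig nu ->
  (forall l, mu (cyl l) = nu (cyl l)) -> forall A, Sig A -> mu A = nu A.
Proof.
move=> hmu hnu e; apply: (fin_measure_unique R (range cyl)) => //.
- move=> _ _ [l _ <-] [l' _ <-]; exists (l ++ l')%list => //.
  apply/seteqP; split => [w hw|w [h1 h2] i /List.in_app_iff[/h1|/h2]//].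
  by split => i li; apply: hw; apply/List.in_app_iff; [left|right].
- by exists nil => //; exact: cyl_nil.
- apply: smallest_sub; first exact: smallest_sigma_algebra.
  move=> _ [t [a ->]]; apply: sub_sigma_algebra; exists (existT _ t a :: nil) => //.
  by rewrite cyl_cons cyl_nil setIT.
- by move=> _ [l _ <-]; exact: Sigma_cyl.
- by move=> _ [l _ <-].
Qed.

Lemma spectral_unique x mu nu : spectral x mu -> spectral x nu ->
  forall A, Sig A -> mu A = nu A.
Proof. by move=> [hmu emu] [hnu enu]; apply: cyl_unique => // l; rewrite emu enu. Qed.

Lemma spectral_setT x mu : spectral x mu -> mu setT = (nsq x)%:E.
Proof.
move=> [_ e]; rewrite -cyl_nil e; congr (_%:E); congr nsq.
apply/(proj_id _ _ _ hip hcompl); last by move=> P [].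
exact: pmeet_closed_subspace (List.Forall_nil _).
Qed.

Lemma spectral_scale c x mu : spectral x mu ->
  spectral (c *: x) (fun B => (cabs2 R c)%:E * mu B)%E.
Proof.
move=> [hmu e]; split.
  by apply: fin_measure_scale => //; rewrite addr_ge0 ?sqr_ge0.
move=> l; rewrite e (projectionZ _ _ _ _ (proj_of_projection l)).
by rewrite (nsqZ _ _ _ hip) EFinM.
Qed.

(** On cylinders the parallelogram law says that the measures of [x + y] and [x - y] add up to the
    right-hand side. Uniqueness extends this to [Sig], and the measure of [x - y] is then
    dropped. *)
Lemma spectral_le_add x y mu nu rho : H_comm x -> H_comm y ->
  spectral x mu -> spectral y nu -> spectral (x + y) rho ->
  forall B, Sig B -> (rho B <= (mu B + mu B) + (nu B + nu B))%E.
Proof.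
move=> hx hy [hmu emu] [hnu enu] [hrho erho] B SB.
have [sig [hsig esig]] :=
  spectral_exists _ (closed_subspaceB _ _ _ H_comm_closed_subspace _ _ hx hy).
suff <- : (rho B + sig B = (mu B + mu B) + (nu B + nu B))%E.
  by rewrite leeDl//; case: hsig => _ pos _ _; exact: pos.
move: B SB; apply: cyl_unique.
- exact: fin_measure_add.
- by apply: fin_measure_add; exact: fin_measure_add.
- move=> l; rewrite emu enu erho esig -!EFinD; congr (_%:E).
  have hP := proj_of_projection l.
  rewrite (projectionD _ _ _ _ hP) (projectionB _ _ _ _ hP).
  by rewrite (parallelogram _ _ _ hip); lra.
Qed.

(** As [P] commutes with the products, Pythagoras on cylinders splits [mu] into [nu] and the measure
    of [x - P x]. *)
Lemma spectral_le_projection P x mu nu : is_projection P ->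
  (forall t (a : Delta t) y, P (p t a y) = p t a (P y)) ->
  H_comm x -> H_comm (P x) -> spectral x mu -> spectral (P x) nu ->
  forall B, Sig B -> (nu B <= mu B)%E.
Proof.
move=> hP comm hx hPx [hmu emu] [hnu enu] B SB.
have hd := closed_subspaceB _ _ _ H_comm_closed_subspace _ _ hx hPx.
have [sig [hsig esig]] := spectral_exists _ hd.
suff -> : (mu B = nu B + sig B)%E.
  by rewrite leeDl//; case: hsig => _ pos _ _; exact: pos.
move: B SB; apply: cyl_unique => //; first exact: fin_measure_add.
move=> l; rewrite emu enu esig -EFinD; congr (_%:E).
rewrite (projectionB _ _ _ _ (proj_of_projection l)) !proj_of_prod//.
rewrite -(prod_ops_commute P); first exact: projection_pythagoras.
by move=> W /List.in_map_iff[[t a] [<- _]] y; exact: comm.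
Qed.

Lemma cabs2_hnormV x : cabs2 R (hnorm R H ip x)^-1 = (nsq x)^-1.
Proof.
apply: complexI; rewrite /cabs2 add_Re2_Im2 normfV exprVn -normrX /hnorm sqrtCK.
rewrite -[ip x x]/(sqnorm R H ip x) (sqnormE _ _ _ hip) ger0_norm ?fmorphV//.
by rewrite ler0c; exact: nsq_ge0.
Qed.

Lemma nsq_proj_of_hat l x :
  complex.Re (sqnorm R H ip (proj_of l (hat R H ip x))) = (nsq x)^-1 * nsq (proj_of l x).
Proof.
rewrite -[LHS]/(nsq _) /hat (projectionZ _ _ _ _ (proj_of_projection l)).
by rewrite (nsqZ _ _ _ hip) cabs2_hnormV.
Qed.

(** * The subspaces attached to events *)

Local Notation H_event := (H_event R H ip T Delta p).
Local Notation is_P_phi := (is_P_phi R H ip T Delta p).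

Lemma probability_fin_measure mu : is_probability R T Delta mu <->
  fin_measure_on R _ Sig mu /\ mu setT = 1%E.
Proof.
split=> [[mu0 pos add mu1]|[[mu0 pos add _] mu1]].
  split => //; split => //; last by rewrite mu1 ltry.
  by move=> F SF tF; rewrite add// nneseries_sup// => n; exact: pos.
split => // F SF tF; rewrite add// nneseries_sup// => n; exact: pos.
Qed.

Lemma is_P_phi_spectral x mu : x <> 0 -> is_P_phi x mu ->
  spectral x (fun B => (nsq x)%:E * mu B)%E.
Proof.
move=> x0 [/probability_fin_measure[hmu _] emu]; split.
  by apply: fin_measure_scale => //; exact: nsq_ge0.
move=> l; rewrite emu nsq_proj_of_hat -EFinM mulrA mulfV ?mul1r//.
by apply/eqP => /(nsq_eq0 _ _ _ hip).
Qed.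

Lemma spectral_is_P_phi x mu : x <> 0 -> spectral x mu ->
  is_P_phi x (fun B => (nsq x)^-1%:E * mu B)%E.
Proof.
move=> x0 hx; have [hmu emu] := hx.
have i0 : 0 <= (nsq x)^-1 by rewrite invr_ge0; exact: nsq_ge0.
split.
  apply/probability_fin_measure; split; first exact: fin_measure_scale.
  rewrite (spectral_setT _ _ hx) -EFinM mulVf//.
  by apply/eqP => /(nsq_eq0 _ _ _ hip).
by move=> l; rewrite emu nsq_proj_of_hat EFinM.
Qed.

(** The condition that the complement is null needs no normalisation, treats [x = 0] uniformly, and
    is inherited under domination of measures. *)
Lemma H_event_spectral A x : Sig A ->
  H_event A x <-> H_comm x /\ exists mu, spectral x mu /\ mu (~` A) = 0%E.
Proof.
move=> SA; have SAC := sigma_setC _ SA.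
split=> [[hx hA]|[hx [mu [hmu muA]]]].
- split => //; have [x0|x0] := pselect (x = 0).
    have [nu hnu] := spectral_exists _ hx; exists nu; split => //.
    have [hfin _] := hnu; have := fin_measureC R hfin A SA.
    rewrite (spectral_setT _ _ hnu) x0 (nsq0 _ _ _ hip).
    by case: hfin => _ pos _ _ /eqP; rewrite padde_eq0 ?pos// => /andP[_ /eqP].
  have {hA} [//|[mu [hmu muA]]] := hA.
  exists (fun B => (nsq x)%:E * mu B)%E; split; first exact: is_P_phi_spectral.
  have /probability_fin_measure[hfin mu1] := hmu.1.
  have := fin_measureC R hfin _ SA; rewrite muA mu1.
  have := fin_measure_fin R hfin _ SAC; case: (mu _) => // r _ [] /eqP.
  by rewrite -subr_eq0 addrAC subrr add0r => /eqP ->; rewrite mule0.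
- split => //; have [->|x0] := pselect (x = 0); [by left|right].
  exists (fun B => (nsq x)^-1%:E * mu B)%E; split; first exact: spectral_is_P_phi.
  have [hfin _] := hmu; have := fin_measureC R hfin _ SA.
  rewrite muA adde0 (spectral_setT _ _ hmu) => ->; rewrite -EFinM mulVf//.
  by apply/eqP => /(nsq_eq0 _ _ _ hip).
Qed.

Lemma H_event_closed_subspace A : Sig A -> closed_subspace (H_event A).
Proof.
move=> SA; have cH := H_comm_closed_subspace; have [H0 Hlin Hcl] := cH.
have SAC := sigma_setC _ SA.
have pos x mu : spectral x mu -> (0 <= mu (~` A))%E.
  by move=> [[_ h _ _] _]; exact: h.
split.
- by split => //; left.
- move=> c x y /(H_event_spectral _ _ SA)[hx [mu [hmu mu0]]].
  move=> /(H_event_spectral _ _ SA)[hy [nu [hnu nu0]]].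
  apply/(H_event_spectral _ _ SA); split; first exact: Hlin.
  have hcx := closed_subspaceZ _ _ _ cH c _ hx.
  have [rho hrho] := spectral_exists _ (Hlin c _ _ hx hy).
  exists rho; split => //; apply/eqP; rewrite eq_le (pos _ _ hrho) andbT.
  have := spectral_le_add _ _ _ _ _ hcx hy (spectral_scale c _ _ hmu) hnu hrho _ SAC.
  by rewrite mu0 nu0 mule0 !adde0.
- move=> x xe; apply/(H_event_spectral _ _ SA).
  have hx : H_comm x by apply: Hcl => e /xe[y [hy _] yx]; exists y.
  split => //; have [rho hrho] := spectral_exists _ hx; exists rho; split => //.
  apply/eqP; rewrite eq_le (pos _ _ hrho) andbT; apply/lee_addgt0Pr => e e0.
  (* Writing [x = y + (x - y)], the part [y] gives the complement no mass and [x - y] contributes at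
     most twice its squared norm, which is below [e]. *)
  have [|y /(H_event_spectral _ _ SA)[hy [mu [hmu mu0]]] yx] := xe (e / 2).
    by rewrite divr_gt0.
  have hd := closed_subspaceB _ _ _ cH _ _ hx hy.
  have [nu hnu] := spectral_exists _ hd.
  have e1 : x = y + (x - y) by rewrite addrC subrK.
  rewrite e1 in hrho.
  apply: le_trans (spectral_le_add _ _ _ _ _ hy hd hmu hnu hrho _ SAC) _.
  rewrite mu0 !add0e; have [hfin _] := hnu.
  have nule : (nu (~` A) <= (nsq (x - y))%:E)%E.
    rewrite -(spectral_setT _ _ hnu) -(fin_measureC R hfin _ SA) leeDr//.
    by case: hfin => _ h _ _; exact: h.
  apply: le_trans (leeD nule nule) _; rewrite -EFinD lee_fin.
  by rewrite (nsqBC _ _ _ hip); lra.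
Qed.

End Family.

(** * Comparison of a family with a refinement *)

Section Refinement.
Variables (S' : Type) (S : set S').
Variables (Gam : {t : S' | S t} -> countType) (p : forall t, Gam t -> H -> H).
Variables (Gam' : S' -> countType) (p' : forall t, Gam' t -> H -> H).
Variable blk : forall t : {t : S' | S t}, Gam' (proj1_sig t) -> Gam t.
Hypothesis href : is_refinement R H ip S' S Gam p Gam' p' blk.

Let hp : is_pvm_family R H ip _ Gam p. Proof. by case: href. Qed.
Let hp' : is_pvm_family R H ip _ Gam' p'. Proof. by case: href. Qed.
Let hblk (t : {t : S' | S t}) (a : Gam t) :
  strong_sum_on R H ip (Gam' (proj1_sig t)) [set b | blk t b = a] (p' (proj1_sig t)) (p t a).
Proof. by case: href => _ _; apply. Qed.

Local Notation H_comm' := (H_comm R H _ Gam' p').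
Local Notation H_comm := (H_comm R H _ Gam p).
Local Notation lift := (lift_event S' S Gam Gam' blk).
Local Notation spectral' := (spectral _ Gam' p').
Local Notation spectral := (spectral _ Gam p).

Let proj_p t a : is_projection (p t a). Proof. by case: hp. Qed.
Let proj_p' t a : is_projection (p' t a). Proof. by case: hp'. Qed.
Let cH' : closed_subspace H_comm' := H_comm_closed_subspace _ _ _ hp'.

Lemma refined_comm t (a : Gam t) s (b : Gam' s) x : H_comm' x ->
  p' s b (p t a x) = p t a (p' s b x).
Proof.
move=> hx; apply: (strong_sum_commute _ _ _ hip _ _ _ _ (hblk t a)) => // c _.
exact: H_comm_swap.
Qed.

Lemma H_comm'_stable t (a : Gam t) x : H_comm' x -> H_comm' (p t a x).
Proof.
move=> hx; apply: (strong_sum_closed _ _ _ hip _ _ _ _ (hblk t a)) => // c _.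
exact: H_comm_stable.
Qed.

(** Each coarse projection is a strong sum of fine ones, so it preserves the closed subspace
    [H_comm'] and commutes there with the others. *)
Lemma H_comm_refined : H_comm' `<=` H_comm.
Proof.
apply: sub_H_comm; first exact: H_comm'_stable.
move=> t a s b x hx.
apply: (strong_sum_commute _ _ _ hip _ _ _ _ (hblk s b)) => // c _.
by rewrite refined_comm.
Qed.

Local Notation ppi' := (p_comm R H ip _ Gam' p').

(** Each fine projection leaves [H_comm'] invariant and so commutes with [ppi']; this passes to
    strong sums. The identity holds on all of [H], as vectors of the event subspace may lie outside
    [H_comm']. *)
Lemma ppi'_commute t (a : Gam t) x : ppi' (p t a x) = p t a (ppi' x).
Proof.
have [hP _] := projP _ _ _ hip hcompl _ cH'.
apply: (strong_sum_commute _ _ _ hip _ _ _ _ (hblk t a)) => // c _.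
by rewrite (proj_commute _ _ _ hip hcompl) //; exact: H_comm_stable.
Qed.

Let coarsen (w' : Omega _ Gam') : Omega _ Gam := fun t => blk t (w' (proj1_sig t)).

(** The point [w] in the definition of the lift is forced to be [coarsen w'], so lifting commutes
    with all set operations. *)
Lemma lift_eventE A : lift A = coarsen @^-1` A.
Proof.
apply/seteqP; split => [w' [w [Aw e]]|w' Aw'].
  by rewrite /preimage /= (_ : coarsen w' = w)//; apply: functional_extensionality_dep.
by exists (coarsen w').
Qed.

Lemma lift_coord t (a : Gam t) : lift [set w | w t = a] =
  \bigcup_(b in [set b | blk t b = a]) [set w' : Omega _ Gam' | w' (proj1_sig t) = b].
Proof.
rewrite lift_eventE; apply/seteqP; split => [w' /= e|w' [b /= <- <-]//].
by exists (w' (proj1_sig t)).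
Qed.

Lemma Sigma_lift A : Sigma _ Gam A -> Sigma _ Gam' (lift A).
Proof.
move=> SA; suff : Sigma _ Gam `<=` [set B | Sigma _ Gam' (lift B)] by apply.
apply: smallest_sub.
- split => /=.
  + by rewrite lift_eventE preimage_set0; exact: sigma_algebra0.
  + move=> B; rewrite !lift_eventE setTD preimage_setC; exact: sigma_setC.
  + move=> F SF; rewrite lift_eventE preimage_bigcup.
    by apply: sigma_algebra_bigcup => n; rewrite -lift_eventE; exact: SF.
- move=> _ [t [a ->]] /=; rewrite lift_coord.
  apply: sigma_countable_bigcup => b _; exact: Sigma_coord.
Qed.

(** The coarse measure is the image of the fine one: a coarse condition is a countable disjoint
    union of fine ones, and [strong_sum_nsq] adds up their masses. *)
Lemma spectral_lift x mu' : H_comm' x -> spectral' x mu' -> spectral x (mu' \o lift).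
Proof.
move=> hx [hmu' emu']; split.
  have [mu0 pos add fin] := hmu'; split => /=.
  - by rewrite lift_eventE preimage_set0.
  - by move=> B SB; apply: pos; exact: Sigma_lift.
  - move=> F SF tF; rewrite lift_eventE preimage_bigcup add.
    + by apply: eq_eseriesr => n _; rewrite lift_eventE.
    + by move=> n; rewrite -lift_eventE; exact: Sigma_lift.
    + by move=> i j _ _ [w [wi wj]]; apply: (tF i j) => //; exists (coarsen w).
  - by rewrite lift_eventE preimage_setT.
(* refine the coordinates of [l] one at a time, moving them to [l'] *)
suff gen l : forall l', mu' (lift (cyl_of _ Gam l) `&` cyl_of _ Gam' l') =
    (nsq (proj_of R H ip _ Gam p l (proj_of R H ip _ Gam' p' l' x)))%:E.
  move=> l /=; have := gen l nil; rewrite cyl_nil setIT => ->.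
  by rewrite (proj_of_prod _ _ _ hp' nil).
have stab' l' : H_comm' (proj_of R H ip _ Gam' p' l' x).
  rewrite (proj_of_prod _ _ _ hp')//; elim: l' => //= i l' IH.
  exact: H_comm_stable.
(* A fine projection can be pulled out through the remaining coarse ones, which matches the fine
   condition added to [l']. *)
have swap k s (b : Gam' s) y : H_comm' y ->
    proj_of R H ip _ Gam p k (p' s b y) = p' s b (proj_of R H ip _ Gam p k y).
  move=> hy; have hby := H_comm_stable _ _ _ s b _ hy.
  rewrite !(proj_of_prod _ _ _ hp); [|exact: H_comm_refined..].
  suff [-> _] : prod_ops (map (fun i => p (projT1 i) (projT2 i)) k) (p' s b y) =
     p' s b (prod_ops (map (fun i => p (projT1 i) (projT2 i)) k) y) /\
     H_comm' (prod_ops (map (fun i => p (projT1 i) (projT2 i)) k) y) by [].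
  elim: k => //= i k [-> hk]; split; first by rewrite refined_comm.
  exact: H_comm'_stable.
elim: l => [|[t a] l IH] l'.
  rewrite cyl_nil lift_eventE preimage_setT setTI emu' (proj_of_prod _ _ _ hp nil)//.
  exact: H_comm_refined.
rewrite cyl_cons lift_eventE preimage_setI -!lift_eventE lift_coord.
rewrite -setIA setI_bigcupl (fin_measure_bigcup R _ _ _ hmu'); last 2 first.
- move=> b _; apply: sigma_setI; first exact: Sigma_coord.
  by apply: sigma_setI; [exact: Sigma_lift (Sigma_cyl _ _ _)|exact: Sigma_cyl].
- move=> b c _ _ bc; apply/seteqP; split => // w' [[/= e1 _] [/= e2 _]].
  by apply: bc; rewrite -e1 -e2.
rewrite (proj_of_cons _ _ _ hp); last exact/H_comm_refined/stab'.
rewrite -(strong_sum_nsq _ _ _ hip _ _ _ _ (hblk t a))//.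
apply: eq_esum => b _; rewrite setICA -cyl_cons IH (proj_of_cons _ _ _ hp')//.
by rewrite swap.
Qed.

(** For [x] in [H_comm'], the image of the fine measure is the coarse one by uniqueness, so the
    complements of [A] and of its lift are null together. *)
Lemma H_event_lift A : Sigma _ Gam A ->
  H_event R H ip _ Gam' p' (lift A) = H_event R H ip _ Gam p A `&` H_comm'.
Proof.
move=> SA; have SA' := Sigma_lift _ SA.
have liftC : lift (~` A) = ~` lift A by rewrite !lift_eventE preimage_setC.
apply/seteqP; split => x.
  move=> /(H_event_spectral _ _ _ hp' _ _ SA')[hx [mu' [hmu' mu'0]]]; split => //.
  apply/(H_event_spectral _ _ _ hp _ _ SA); split; first exact: H_comm_refined.
  by exists (mu' \o lift); split; [exact: spectral_lift|rewrite /= liftC].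
move=> [/(H_event_spectral _ _ _ hp _ _ SA)[_ [mu [hmu mu0]]] hx].
apply/(H_event_spectral _ _ _ hp' _ _ SA'); split => //.
have [mu' hmu'] := spectral_exists _ _ _ hp' _ hx; exists mu'; split => //.
rewrite -liftC -mu0.
exact: (spectral_unique _ _ _ _ _ _ (spectral_lift _ _ hx hmu') hmu _ (sigma_setC _ SA)).
Qed.

Lemma ppi'_H_event A x : Sigma _ Gam A ->
  H_event R H ip _ Gam p A x -> H_event R H ip _ Gam p A (ppi' x).
Proof.
move=> SA /(H_event_spectral _ _ _ hp _ _ SA)[hx [mu [hmu mu0]]].
have hPx : H_comm (ppi' x) by apply: H_comm_refined; exact: (proj_in _ _ _ hip hcompl).
apply/(H_event_spectral _ _ _ hp _ _ SA); split => //.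
have [nu hnu] := spectral_exists _ _ _ hp _ hPx; exists nu; split => //.
have SAC := sigma_setC _ SA.
apply/eqP; rewrite eq_le; apply/andP; split; last first.
  by case: hnu => -[_ pos _ _] _; exact: pos.
rewrite -mu0; apply: (spectral_le_projection _ _ _ hp ppi') hx hPx hmu hnu _ SAC.
  exact: (proj1 (projP _ _ _ hip hcompl _ cH')).
exact: ppi'_commute.
Qed.

End Refinement.
End CommutingFamilies.

Theorem theorem8 (R : realType) (H : lmodType R[i]) (ip : H -> H -> R[i])
  (hH : is_hilbert R H ip)
  (S' : Type) (S : set S')
  (Gam : {t : S' | S t} -> countType) (p : forall t, Gam t -> H -> H)
  (Gam' : S' -> countType) (p' : forall t, Gam' t -> H -> H)
  (blk : forall t : {t : S' | S t}, Gam' (proj1_sig t) -> Gam t)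
  (href : is_refinement R H ip S' S Gam p Gam' p' blk)
  (A : set (Omega _ Gam))
  (hA : Sigma _ Gam A) :
  let A' := lift_event S' S Gam Gam' blk A in
  let pA := p_event R H ip _ Gam p A in
  let pA' := p_event R H ip _ Gam' p' A' in
  let ppi' := p_comm R H ip _ Gam' p' in
  Sigma _ Gam' A' /\
  [/\ pA' = (fun x => pA (ppi' x)),
      pA' = (fun x => ppi' (pA x)),
      pA' = pmeet R H ip pA ppi',
      (fun x => pA (ppi' x)) = (fun x => ppi' (pA x)) &
      H_event R H ip _ Gam' p' A' = H_event R H ip _ Gam p A `&` H_comm R H _ Gam' p'].
Proof.
move=> A' pA pA' ppi'.
have [hp hp' _] := href; have [hip hcompl] := hH.
have hE := H_event_lift _ _ _ hH _ _ _ _ _ _ _ href _ hA.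
have cA := H_event_closed_subspace _ _ _ hH _ _ _ hp _ hA.
have cpi' := H_comm_closed_subspace _ _ _ hH _ _ _ hp'.
have [hP rP] := projP _ _ _ hip hcompl _ cpi'.
have [_ rA] := projP _ _ _ hip hcompl _ cA.
have inv := fun x => ppi'_H_event _ _ _ hH _ _ _ _ _ _ _ href _ x hA.
have comm : (fun x => pA (ppi' x)) = (fun x => ppi' (pA x)).
  apply/funext => x; apply/esym; exact: (proj_commute _ _ _ hip hcompl).
have pA'E : pA' = (fun x => ppi' (pA x)).
  (* Here [P] is [ppi'] and [W] is the event subspace of [A]; by [hE] their intersection is the
     event subspace of the lift. *)
  have := proj_comp _ _ _ hip hcompl _ _ hP cA inv.
  by rewrite rP setIC -hE.
split; first exact: Sigma_lift.
split => //.
- by rewrite comm.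
- by rewrite /pmeet rA rP -hE.
Qed.
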